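(* Let $V$ be a commutative valuation domain with quotient field $F$, $K/F$ a finite Galois extension with group $G$, $S$ the integral closure of $V$ in $K$, $f:G\times G\to S\setminus\{0\}$ a normalized $2$-cocycle and $H=\{\sigma\in G:f(\sigma,\sigma^{-1})\in U(S)\}$. Then $A_f$ is an Azumaya algebra over $V$ if and only if $H=G$ and $K/F$ is unramified and defectless.
   Context: $V$ has arbitrary Krull dimension. A normalized 2-cocycle satisfies $\sigma(f(\tau,\gamma))f(\sigma,\tau\gamma)=f(\sigma,\tau)f(\sigma\tau,\gamma)$, $f(1,\sigma)=f(\sigma,1)=1$; values need not be units. $A_f=\bigoplus_{\sigma\in G}Sx_\sigma$ (free left $S$-module) with $(sx_\sigma)(tx_\tau)=s\,\sigma(t)f(\sigma,\tau)x_{\sigma\tau}$; its center is $V$. $U(S)$ is the unit group of $S$. For a maximal ideal $M$ of $S$, with $e=[\Gamma_{S_M}:\Gamma_V]$, residue fields $\overline{S_M},\overline V$ and $r$ the number of maximal ideals of $S$: $K/F$ is defectless if $[K:F]=e[\overline{S_M}:\overline V]r$, and unramified if $e=1$ and $\overline{S_M}/\overline V$ is separable. *)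

(* Defs.v *)
From HB Require Import structures.
From mathcomp Require Import all_boot all_order all_algebra all_fingroup all_field.
Set Implicit Arguments. Unset Strict Implicit. Unset Printing Implicit Defensive.
Import GRing.Theory.
Local Open Scope ring_scope.

Section Defs.
Variables (F : fieldType) (L : splittingFieldType F).

(* Galois group G = gal_of {:L}; composition in the paper's convention:
   (gcomp s t) x = s (t x).  (MathComp's product acts as (s*t) x = t (s x).) *)
Definition galT := gal_of (fullv : {vspace L}).
Definition gcomp (s t : galT) : galT := (t * s)%g.

Definition subring_of (V : F -> Prop) :=
  [/\ V 0, V 1, (forall x y, V x -> V y -> V (x - y)) & (forall x y, V x -> V y -> V (x * y))].
(* a valuation domain of F (whose quotient field is then F) *)
Definition valuation_domain (V : F -> Prop) :=
  subring_of V /\ (forall x : F, x != 0 -> V x \/ V x^-1).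
Definition max_idV (V : F -> Prop) (x : F) := V x /\ (x = 0 \/ ~ V x^-1).

Definition polyOverP (V : F -> Prop) (p : {poly F}) := forall i, V p`_i.

Definition intclos (V : F -> Prop) (x : L) :=
  exists p : {poly F}, [/\ p \is monic, polyOverP V p & root (map_poly (in_alg L) p) x].
Definition unitS (V : F -> Prop) (x : L) := [/\ intclos V x, x != 0 & intclos V x^-1].

Definition ideal_of (V : F -> Prop) (M : L -> Prop) :=
  [/\ forall x, M x -> intclos V x, M 0,
      forall x y, M x -> M y -> M (x + y)
    & forall s x, intclos V s -> M x -> M (s * x)].
Definition max_ideal (V : F -> Prop) (M : L -> Prop) :=
  [/\ ideal_of V M, ~ M 1 &
      forall I, ideal_of V I -> ~ I 1 -> (forall x, M x -> I x) -> forall x, I x -> M x].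
Definition num_max_ideals (V : F -> Prop) (r : nat) :=
  exists Ms : 'I_r -> (L -> Prop),
    [/\ forall i, max_ideal V (Ms i),
        forall i j, i != j -> exists x, ~ (Ms i x <-> Ms j x)
      & forall M, max_ideal V M -> exists i, forall x, M x <-> Ms i x].

Definition locS (V : F -> Prop) (M : L -> Prop) (x : L) :=
  exists a b, [/\ intclos V a, intclos V b, ~ M b & x = a / b].
Definition locM (V : F -> Prop) (M : L -> Prop) (x : L) :=
  exists a b, [/\ M a, intclos V b, ~ M b & x = a / b].
Definition unit_locS V M (x : L) := [/\ locS V M x, x != 0 & locS V M x^-1].

(* e = [Gamma_{S_M} : Gamma_V] = |L^* / (F^* U(S_M))| *)
Definition val_equiv V M (x y : L) :=
  exists (c : F) (u : L), [/\ c != 0, unit_locS V M u & x = c%:A * u * y].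
Definition ram_index V M (e : nat) :=
  exists reps : 'I_e -> L,
    [/\ forall i, reps i != 0,
        forall i j, i != j -> ~ val_equiv V M (reps i) (reps j)
      & forall x, x != 0 -> exists i, val_equiv V M x (reps i)].

(* f = [S_M / M S_M : V / m] : size of a family in S_M whose residues form a
   basis over the residue field of V *)
Definition res_degree V M (f : nat) :=
  exists t : 'I_f -> L,
    [/\ forall i, locS V M (t i),
        forall v : 'I_f -> F, (forall i, V (v i)) ->
          locM V M (\sum_i (v i)%:A * t i) -> forall i, max_idV V (v i)
      & forall x, locS V M x -> exists v : 'I_f -> F,
          (forall i, V (v i)) /\ locM V M (x - \sum_i (v i)%:A * t i)].

(* residue field extension S_M/M S_M over V/m is separable: every residue class
   is a root of a polynomial over V/m that is coprime to its derivative *)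
Definition res_separable V M :=
  forall x, locS V M x ->
    exists p : {poly F}, polyOverP V p /\ locM V M (map_poly (in_alg L) p).[x] /\
      exists a b : {poly F}, [/\ polyOverP V a, polyOverP V b &
        forall i, max_idV V (a * p + b * p^`() - 1)`_i].

Definition defectless V :=
  forall M, max_ideal V M -> exists e f r,
    [/\ ram_index V M e, res_degree V M f, num_max_ideals V r & \dim {:L} = (e * f * r)%N].
Definition unramified V :=
  forall M, max_ideal V M -> ram_index V M 1 /\ res_separable V M.

Definition normalized_cocycle V (f : galT -> galT -> L) :=
  [/\ forall s t : galT, intclos V (f s t) /\ f s t != 0,
      forall s t g : galT, s (f t g) * f s (gcomp t g) = f s t * f (gcomp s t) g
    & forall s : galT, f 1%g s = 1 /\ f s 1%g = 1].

(* elements of A_f = \bigoplus_s S x_s are represented by coefficient functions *)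
Definition crossT := {ffun galT -> L}.
Definition inA V (a : crossT) := forall s, intclos V (a s).
Definition mulA (f : galT -> galT -> L) (a b : crossT) : crossT :=
  [ffun r => \sum_(s : galT) a s * s (b (gcomp s^-1%g r)) * f s (gcomp s^-1%g r)].
Definition scaleA (v : F) (a : crossT) : crossT := [ffun r => v%:A * a r].

(* Azumaya algebra over V (Auslander-Goldman): A is a finitely generated
   projective (= free, V being local) faithful V-module and the sandwich map
   A (x)_V A^op -> End_V(A), a (x) b |-> (x |-> a x b), is an isomorphism;
   with a V-basis b_1..b_N of A, A (x) A^op is free on the b_i (x) b_j. *)
Definition azumaya V (f : galT -> galT -> L) :=
  exists N (b : 'I_N -> crossT),
  [/\ forall i, inA V (b i),
      forall a, inA V a -> exists c : 'I_N -> F,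
        (forall i, V (c i)) /\ a = \sum_i scaleA (c i) (b i),
      forall c : 'I_N -> F, (forall i, V (c i)) ->
        \sum_i scaleA (c i) (b i) = 0 -> forall i, c i = 0,
      forall v, V v -> (forall a, inA V a -> scaleA v a = 0) -> v = 0
    & forall phi : crossT -> crossT,
        (forall a, inA V a -> inA V (phi a)) ->
        (forall v w a a', V v -> V w -> inA V a -> inA V a' ->
           phi (scaleA v a + scaleA w a') = scaleA v (phi a) + scaleA w (phi a')) ->
        exists c : 'I_N -> 'I_N -> F,
          [/\ forall i j, V (c i j),
              forall x, inA V x -> phi x = \sum_i \sum_j scaleA (c i j) (mulA f (mulA f (b i) x) (b j))
            & forall c' : 'I_N -> 'I_N -> F, (forall i j, V (c' i j)) ->
                (forall x, inA V x -> phi x = \sum_i \sum_j scaleA (c' i j) (mulA f (mulA f (b i) x) (b j))) ->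
                c' = c]].

End Defs.

(* Main.v *)
(* A_f is Azumaya exactly when the values f(s, s^-1) are units and S/V is Galois
   in the sense that there are x_i, y_i in S with sum_i x_i s(y_i) = [s = 1]
   for all s in G.  One direction writes suitable V-linear maps A_f -> A_f as
   sandwiches and compares coefficients by Dedekind independence; conversely
   s = sum_i tr(s y_i) x_i makes S free over V, and explicit sandwiches give all of
   End_V(A_f).

   It remains to see that such a system exists exactly when K/F is unramified
   and defectless.  If e = 1 and n = f r, the Chinese remainder theorem yields a
   V-basis of S; a valuation estimate on a separable equation shows that all
   inertia groups are trivial, so for s <> 1 the elements b - s(b) generate the
   unit ideal of S, and the tensors so obtained multiply to the required one.
   Conversely, given the system, every z in K is c w with c in F and tr(w y_i) = 1
   for some i; applied to the products of the conjugates of z of value less than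
   (respectively, also including) that of z this gives e = 1.  An element of S
   fixed modulo M by the decomposition group is congruent to an element of V,
   whence separability, and Nakayama's lemma gives n = f r. *)
Require Import Defs.
From HB Require Import structures.
From mathcomp Require Import all_boot all_order all_algebra all_fingroup all_field.
From mathcomp Require Import boolp classical_sets.
From mathcomp Require Import ring zify.
Set Implicit Arguments. Unset Strict Implicit. Unset Printing Implicit Defensive.
Import GRing.Theory.
Local Open Scope ring_scope.

(** As [V] may have any rank, there is no uniformizer to divide by, and finiteness of [S] over [V]
    is not given in advance. Two devices take their place. In a finite family of [F] some nonzero
    element has least value; dividing by it makes one coefficient 1 and keeps the others in [V],
    which normalizes relations, equations and trace coordinates. And the system [x_i], [y_i] carries
    finiteness: traces against the [y_i] are coordinates with respect to the [x_i], so minimal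
    families and Nakayama's lemma become available. Neither value groups nor residue fields are
    constructed. Values at [M] are compared by membership of quotients in [S_M], a value coming from
    [F] is a factorization [c * u] with [u] a unit of [S_M], and polynomials over a residue field
    are lifts, equality being congruence of coefficients. Values of [f] that are not units do no
    harm when coefficients are compared: there the arguments rest on their being nonzero or on
    normalization. The explicit sandwiches invert the elements [f s s^-1] alone. *)

(* Bundled, so that the closure instances below can be inferred from [V]. *)
Structure galval (F : fieldType) (L : splittingFieldType F) := GalVal {
  gv_pred :> F -> Prop;
  gv_val : valuation_domain gv_pred;
  gv_gal : galois 1%VS (fullv : {vspace L})
}.

(** * Valuation rings and their maximal ideals *)

Section ValuationRing.
Variables (F : fieldType) (L : splittingFieldType F) (V : galval L).

Definition vring : {pred F} := fun x => `[< V x >].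
Definition vmax : {pred F} := fun x => `[< max_idV V x >].

Lemma vringP x : reflect (V x) (x \in vring). Proof. exact: asboolP. Qed.
Lemma vmaxP x : reflect (max_idV V x) (x \in vmax). Proof. exact: asboolP. Qed.

Lemma vring_subring : subring_closed vring.
Proof.
have [[V0 V1 VB VM] _] := gv_val V.
split; first exact/vringP.
  by move=> x y /vringP Vx /vringP Vy; apply/vringP/VB.
by move=> x y /vringP Vx /vringP Vy; apply/vringP/VM.
Qed.
HB.instance Definition _ := GRing.isSubringClosed.Build F vring vring_subring.

Lemma vring_total x : x != 0 -> (x \in vring) || (x^-1 \in vring).
Proof.
by case: (gv_val V) => _ tot /tot[] Vx; apply/orP; [left | right]; apply/vringP.
Qed.

Lemma vmaxE x : x \in vmax = (x \in vring) && ((x == 0) || (x^-1 \notin vring)).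
Proof.
apply/vmaxP/andP=> [[Vx ninv]|[/vringP Vx ninv]]; split=> //; first exact/vringP.
  case: ninv => [->|nV]; first by rewrite eqxx.
  by apply/orP; right; apply/vringP.
by case/orP: ninv => [/eqP|/vringP]; [left | right].
Qed.

Lemma vmax_sub x : x \in vmax -> x \in vring.
Proof. by rewrite vmaxE => /andP[]. Qed.

Lemma vmaxN1 : 1 \notin vmax.
Proof. by rewrite vmaxE invr1 rpred1 oner_eq0. Qed.

Lemma vunit_inv x : x \in vring -> x \notin vmax -> x != 0 /\ x^-1 \in vring.
Proof.
by move=> Vx; rewrite vmaxE Vx /= negb_or negbK => /andP[].
Qed.

Lemma vmaxMl c x : c \in vring -> x \in vmax -> c * x \in vmax.
Proof.
move=> Vc mx; have Vx := vmax_sub mx.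
rewrite vmaxE rpredM //=; case: eqP => //= /eqP; rewrite mulf_eq0 negb_or.
move=> /andP[c0 x0]; move: mx; rewrite vmaxE Vx (negPf x0) /=.
by apply: contra => Vcx; rewrite -(mulfK c0 x^-1) mulrC mulrA rpredM // mulrC -invfM mulrC.
Qed.

Lemma vmax_zmod : zmod_closed vmax.
Proof.
split=> [|x y mx my]; first by rewrite vmaxE rpred0 eqxx.
have [-> | x0] := eqVneq x 0; first by rewrite sub0r -mulN1r vmaxMl // rpredN rpred1.
have [-> | y0] := eqVneq y 0; first by rewrite subr0.
have [Vxy|Vyx] := orP (vring_total (mulf_neq0 x0 (invr_neq0 y0))).
  by rewrite -[x](divfK y0) -[X in _ - X]mul1r -mulrBl vmaxMl ?rpredB ?rpred1.
rewrite -[y](divfK x0) -[X in X - _]mul1r -mulrBl vmaxMl ?rpredB ?rpred1 //.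
by rewrite -invf_div.
Qed.
HB.instance Definition _ := GRing.isZmodClosed.Build F vmax vmax_zmod.

Lemma vmax_inv x : x \notin vring -> x^-1 \in vmax.
Proof.
move=> nVx; have x0: x != 0 by apply: contraNneq nVx => ->; rewrite rpred0.
rewrite vmaxE invrK nVx orbT andbT.
by have := vring_total x0; rewrite (negPf nVx).
Qed.

(** Totality makes one of the nonzero [c i] minimal in value. Dividing a linear relation or a
    polynomial by [c k] leaves coefficients in [V], one of which is 1 and hence outside the maximal
    ideal. *)
Lemma vring_min_val (I : finType) (c : I -> F) i0 : c i0 != 0 ->
  exists2 k, c k != 0 & forall i, c i / c k \in vring.
Proof.
move=> ci0; suff [k ck Vk]: exists2 k, c k != 0 & {in enum I, forall i, c i / c k \in vring}.
  by exists k => // i; apply: Vk; rewrite mem_enum.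
elim: (enum I) => [|j s [k ck Vk]]; first by exists i0.
have [cj | cj] := eqVneq (c j) 0.
  by exists k => // i; rewrite inE => /orP[/eqP-> | /Vk//]; rewrite cj mul0r rpred0.
have [Vjk|Vkj] := orP (vring_total (mulf_neq0 cj (invr_neq0 ck))).
  by exists k => // i; rewrite inE => /orP[/eqP-> | /Vk].
exists j => // i; rewrite inE => /orP[/eqP-> | /Vk Vi]; first by rewrite divff ?rpred1.
rewrite invf_div in Vkj; rewrite -[c i](divfK ck) -(mulrA _ _ (c j)^-1); exact: rpredM.
Qed.

End ValuationRing.
Arguments vring {F L} V.
Arguments vmax {F L} V.

(** * Integral closure, conjugates, traces and norms *)

Section IntegralClosure.
Variables (F : fieldType) (L : splittingFieldType F) (V : galval L).
Local Notation G := (galT L).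

(** [V] as a ring type, so that closure of integral elements under differences and products comes
    from [integralOver]. *)
Definition vsub := {x : F | x \in vring V}.
HB.instance Definition _ := Choice.on vsub.
HB.instance Definition _ := SubType.on vsub.
HB.instance Definition _ := [SubChoice_isSubComNzRing of vsub by <:].

Definition vsub_inL : vsub -> L := in_alg L \o val.
HB.instance Definition _ := GRing.RMorphism.on vsub_inL.

Definition sring : {pred L} := fun x => `[< intclos V x >].
Lemma sringP x : reflect (intclos V x) (x \in sring). Proof. exact: asboolP. Qed.

Lemma sring_integralP x : reflect (integralOver vsub_inL x) (x \in sring).
Proof.
apply: (iffP (sringP x)) => [[p [p_monic Vp px]]|[q q_monic qx]]; last first.
  exists (map_poly val q); split; first exact: monic_map.
    by move=> i; rewrite coef_map; apply/vringP/valP.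
  by rewrite -map_poly_comp.
pose q := \poly_(i < size p) (insubd (0 : vsub) p`_i).
have qE : map_poly val q = p.
  apply/polyP=> i; rewrite coef_map coef_poly.
  case: ltnP => [_|ip]; last by rewrite nth_default //=.
  by rewrite [LHS]val_insubd; move/vringP: (Vp i) => ->.
exists q; last by rewrite /vsub_inL map_poly_comp qE.
have:= p_monic; rewrite -qE !monicE lead_coef_map_inj; [|exact: val_inj|exact: rmorph0].
by rewrite -(inj_eq val_inj) rmorph1.
Qed.

Lemma sring_subring : subring_closed sring.
Proof.
split=> [|x y|x y].
- by apply/sring_integralP/integral1.
- by move=> /sring_integralP Sx /sring_integralP Sy; apply/sring_integralP/integral_sub.
by move=> /sring_integralP Sx /sring_integralP Sy; apply/sring_integralP/integral_mul.
Qed.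
HB.instance Definition _ := GRing.isSubringClosed.Build L sring sring_subring.

Lemma sring_root (p : {poly L}) x : p \is monic -> p \is a polyOver sring ->
  root p x -> x \in sring.
Proof.
move=> p_monic /polyOverP Sp px; apply/sring_integralP.
apply: (integral_root_monic p_monic px).
by apply/integral_poly => i; apply/sring_integralP.
Qed.

Lemma in_alg_eq0 (c : F) : (c%:A == 0 :> L) = (c == 0).
Proof. exact: (fmorph_eq0 (in_alg L)). Qed.

Lemma in_algM (a b : F) : (a * b)%:A = a%:A * b%:A :> L.
Proof. exact: (rmorphM (in_alg L)). Qed.

Lemma in_algV (a : F) : (a^-1)%:A = a%:A^-1 :> L.
Proof. exact: (fmorphV (in_alg L)). Qed.

Lemma in_algB (a b : F) : (a - b)%:A = a%:A - b%:A :> L.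
Proof. exact: (rmorphB (in_alg L)). Qed.

Lemma in_algD (a b : F) : (a + b)%:A = a%:A + b%:A :> L.
Proof. exact: (rmorphD (in_alg L)). Qed.

Lemma in_alg_inj : injective (in_alg L).
Proof. exact: fmorph_inj. Qed.

(** Valuation rings are integrally closed: if [c] is not in [V], then [c^-1] is in the maximal
    ideal, and a monic equation of degree [n] divided by [c ^+ n] puts 1 there too. *)
Lemma sring_in_alg (c : F) : (c%:A \in sring) = (c \in vring V).
Proof.
apply/idP/idP => [|Vc]; last first.
  apply/sringP; exists ('X - c%:P); split; first exact: monicXsubC.
    move=> i; apply/vringP; move: i; apply/polyOverP.
    by rewrite polyOverXsubC.
  by rewrite map_polyXsubC root_XsubC.
move=> /sringP[p [p_monic Vp]].
rewrite (_ : c%:A = in_alg L c) // (fmorph_root (in_alg L)) => /eqP pc0.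
apply: contraT => nVc; have c0 : c != 0 by apply: contraNneq nVc => ->; rewrite rpred0.
have mc := vmax_inv nVc.
have [n spn] : exists n, size p = n.+1.
  by exists (size p).-1; apply/polySpred/monic_neq0.
have /(congr1 (fun x => x / c ^+ n)) := pc0.
rewrite horner_coef spn big_ord_recr /=.
have -> : p`_n = 1 by move/monicP: p_monic; rewrite lead_coefE spn.
rewrite mul1r mul0r mulrDl divff ?expf_neq0 //= => /eqP.
rewrite addr_eq0 -eqr_oppLR => /eqP E; have := vmaxN1 V.
rewrite -E rpredN; case/negP; rewrite mulr_suml.
apply: rpred_sum => i _; rewrite -mulrA vmaxMl //; first exact/vringP.
have -> : c ^+ i / c ^+ n = c^-1 ^+ (n - i).
  apply: (mulIf (expf_neq0 n c0)); rewrite divfK ?expf_neq0 // exprVn.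
  rewrite -[X in _ * c ^+ X](subnK (ltnW (ltn_ord i))) exprD mulrA mulVf ?mul1r //.
  exact: expf_neq0.
move: (ltn_ord i); rewrite -subn_gt0; case: (n - i)%N => // k _.
by rewrite exprSr vmaxMl // rpredX // vmax_sub.
Qed.

Lemma gal_in_alg (s : G) (c : F) : s c%:A = c%:A.
Proof. by rewrite rmorph_alg. Qed.

Lemma galMf (s t : G) x : (s * t)%g x = t (s x).
Proof. by rewrite galM ?memvf. Qed.

Lemma gal1f x : (1%g : G) x = x. Proof. by rewrite gal_id. Qed.

Lemma galVK (s : G) : cancel s (s^-1)%g.
Proof. by move=> x; rewrite -galMf mulgV gal1f. Qed.

Lemma galKV (s : G) : cancel (s^-1)%g s.
Proof. by move=> x; rewrite -galMf mulVg gal1f. Qed.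

Lemma sring_gal (s : G) x : (s x \in sring) = (x \in sring).
Proof.
have sub (t : G) y : y \in sring -> t y \in sring.
  move=> /sringP[p [p_monic Vp py]]; apply/sringP; exists p; split=> //.
  have -> : map_poly (in_alg L) p = map_poly t (map_poly (in_alg L) p).
    by apply/polyP=> i; rewrite !coef_map /= gal_in_alg.
  by rewrite fmorph_root.
apply/idP/idP; last exact: sub.
by move=> /(sub s^-1%g); rewrite galVK.
Qed.

Lemma gal_fixed x : (forall s : G, s x = x) -> exists c : F, x = c%:A.
Proof.
move=> fx; have /galois_fixedField E := gv_gal V.
have: x \in fixedField 'Gal(fullv / (1%VS : {vspace L}))%g.
  by apply/fixedFieldP; rewrite ?memvf // => s _; apply: fx.
by rewrite E => /vlineP.
Qed.

Lemma trace_subproof x : exists c : F, \sum_(s : G) s x = c%:A.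
Proof.
apply: gal_fixed => s; rewrite rmorph_sum /=.
rewrite [RHS](reindex_inj (mulIg s)) /=.
by apply: eq_bigr => t _; rewrite galMf.
Qed.
Definition trF x : F := projT1 (cid (trace_subproof x)).

Lemma trFE x : (trF x)%:A = \sum_(s : G) s x.
Proof. by rewrite /trF; case: (cid _). Qed.

Lemma trF_sring x : x \in sring -> trF x \in vring V.
Proof. by move=> Sx; rewrite -sring_in_alg trFE rpred_sum // => s _; rewrite sring_gal. Qed.

Lemma trFZ c x : trF (c%:A * x) = c * trF x.
Proof.
apply: in_alg_inj; rewrite /= in_algM !trFE mulr_sumr.
by apply: eq_bigr => s _; rewrite rmorphM /= gal_in_alg.
Qed.

Lemma norm_exists x : exists c : F, \prod_(s : G) s x = c%:A.
Proof.
apply: gal_fixed => s; rewrite rmorph_prod /=.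
rewrite [RHS](reindex_inj (mulIg s)) /=.
by apply: eq_bigr => t _; rewrite galMf.
Qed.

Lemma dedekind (a : G -> L) :
  (forall x, \sum_(s : G) a s * s x = 0) -> forall s, a s = 0.
Proof.
move=> a0 s; apply: (@gal_independent _ _ _ predT) => // x _; exact: a0.
Qed.

Lemma vring_clear (p : {poly F}) : p != 0 ->
  exists2 q : {poly F}, q \is a polyOver (vring V) &
  (exists i, q`_i = 1) /\ exists2 c, c != 0 & q = c *: p.
Proof.
move=> p0; have ip : ((size p).-1 < size p)%N by rewrite ltn_predL size_poly_gt0.
have [|k ck Vk] := @vring_min_val _ _ V 'I_(size p) (fun i => p`_i) (Ordinal ip).
  by rewrite /= -lead_coefE lead_coef_eq0.
exists ((p`_k)^-1 *: p).
  apply/polyOverP=> i; rewrite coefZ mulrC.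
  case: (ltnP i (size p)) => [lip|lip]; first exact: (Vk (Ordinal lip)).
  by rewrite nth_default // mul0r rpred0.
split; last by exists (p`_k)^-1; rewrite ?invr_eq0.
by exists k; rewrite coefZ mulVf.
Qed.

(** The minimal polynomial divided by a coefficient of least value. Monicity is given up for
    coefficients in [V] with one equal to 1, which survives modulo every maximal ideal of [S]. *)
Lemma algebraic_vring (x : L) : exists2 q : {poly F}, q \is a polyOver (vring V) &
  (exists i, q`_i = 1) /\ root (map_poly (in_alg L) q) x.
Proof.
have [p p0 px] : exists2 p : {poly F}, p != 0 & root (map_poly (in_alg L) p) x.
  have /polyOver1P[p pE] := minPolyOver 1 x.
  exists p; last by rewrite -pE root_minPoly.
  by apply/eqP=> p0; have := monic_neq0 (monic_minPoly 1 x); rewrite pE p0 rmorph0 eqxx.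
have [q Vq [q1 [c c0 qE]]] := vring_clear p0.
by exists q => //; split=> //; rewrite qE map_polyZ /= rootZ ?in_alg_eq0.
Qed.

(** With [m] the degree and [c] the leading coefficient of [q], the element [c ^+ m.-1 * q.[x]] is
    the value at [c * x] of the monic polynomial [r] below, whose coefficients are in [S]. *)
Lemma lead_mul_root (q : {poly L}) x : q \is a polyOver sring -> root q x ->
  lead_coef q * x \in sring.
Proof.
move=> /polyOverP Sq /eqP qx.
case sq: (size q) => [|m]; first by move/eqP: sq; rewrite size_poly_eq0 => /eqP->; rewrite lead_coef0 mul0r rpred0.
set c := lead_coef q.
pose t := \poly_(i < m) (q`_i * c ^+ (m.-1 - i)); pose r := 'X^m + t.
have sr : (size t < size ('X^m : {poly L}))%N.
  by rewrite size_polyXn ltnS size_poly.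
apply: (@sring_root r).
- by rewrite monicE lead_coefDl // lead_coefXn.
- by rewrite rpredD ?rpredX ?polyOverX //; apply/polyOver_poly => i _; rewrite rpredM ?rpredX ?Sq.
rewrite /root /r /t hornerD hornerXn horner_poly {sr}.
case: m @t @r sq => [|m] t r sq.
  rewrite big_ord0 expr0; move: qx; rewrite horner_coef sq big_ord1 expr0 mulr1 /= => q0.
  have qE := size1_polyC (eq_leq sq).
  by move: (sq); rewrite qE q0 size_poly0.
apply/eqP; transitivity (c ^+ m * q.[x]); last by rewrite qx mulr0.
rewrite horner_coef sq [in RHS]big_ord_recr /= [LHS]addrC mulrDr; congr (_ + _).
  rewrite mulr_sumr; apply: eq_bigr => i _; rewrite exprMn.
  have im : (i <= m)%N by rewrite -ltnS.
  have -> : c ^+ m = c ^+ (m - i) * c ^+ i by rewrite -exprD subnK.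
  by rewrite /=; ring.
have -> : q`_m.+1 = c by rewrite /c lead_coefE sq.
by rewrite exprMn exprS; ring.
Qed.

Lemma sring_fraction (x : L) : exists2 d, d \in vring V & d != 0 /\ d%:A * x \in sring.
Proof.
have [q Vq [[i qi] qx]] := algebraic_vring x.
have q0 : q != 0 by apply: contra_eq_neq qi => ->; rewrite coef0 eq_sym oner_eq0.
exists (lead_coef q); first by move/polyOverP: Vq; apply.
split; first by rewrite lead_coef_eq0.
have := @lead_mul_root (map_poly (in_alg L) q) x.
rewrite lead_coef_map /=; apply=> //.
by apply/polyOverP => j; rewrite coef_map sring_in_alg; move/polyOverP: Vq; apply.
Qed.

Lemma dedekind_sring (a : G -> L) :
  (forall x, x \in sring -> \sum_(s : G) a s * s x = 0) -> forall s, a s = 0.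
Proof.
move=> a0; apply: dedekind => x; have [d Vd [d0 Sdx]] := sring_fraction x.
apply/eqP; have : d%:A * \sum_s a s * s x = 0.
  rewrite -[RHS](a0 _ Sdx) mulr_sumr; apply: eq_bigr => s _.
  by rewrite rmorphM /= gal_in_alg mulrCA.
by move/eqP; rewrite mulf_eq0 in_alg_eq0 (negPf d0).
Qed.

End IntegralClosure.
Arguments sring {F L} V.
Arguments trF {F L} V.

(** * Maximal ideals of [S] and their localizations *)

Structure maxspec (F : fieldType) (L : splittingFieldType F) (V : galval L) :=
  MaxSpec {
    mx_pred :> {pred L};
    mxP : max_ideal V (fun x => x \in mx_pred)
  }.

Section MaximalIdeals.
Variables (F : fieldType) (L : splittingFieldType F) (V : galval L).
Local Notation G := (galT L).
Local Notation S := (sring V).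

Lemma asboolfE (M : L -> Prop) : (fun x => is_true ((fun y => `[< M y >]) x)) = M.
Proof. by apply/funext=> x; apply/propext; split=> /asboolP. Qed.

Definition maxspec_of (M : L -> Prop) (HM : max_ideal V M) : maxspec V :=
  @MaxSpec _ _ _ (fun y => `[< M y >]) (eq_ind_r (max_ideal V) HM (asboolfE M)).

Implicit Type M : maxspec V.

Lemma maxspec_ofE (N : L -> Prop) (HN : max_ideal V N) x :
  (x \in maxspec_of HN) = `[< N x >].
Proof. by []. Qed.

Lemma maxspec_ofK (N : L -> Prop) (HN : max_ideal V N) :
  (fun x => is_true (x \in maxspec_of HN)) = N.
Proof. exact: asboolfE. Qed.

Lemma mx_sub M x : x \in M -> x \in S.
Proof. by case: (mxP M) => [[sub _ _ _] _ _] /sub /sringP. Qed.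

Lemma mxMl M s x : s \in S -> x \in M -> s * x \in M.
Proof. by case: (mxP M) => [[_ _ _ mul] _ _] /sringP Ss; apply: mul. Qed.

Lemma mxMr M s x : s \in S -> x \in M -> x * s \in M.
Proof. by rewrite mulrC; apply: mxMl. Qed.

Lemma mx_zmod M : zmod_closed M.
Proof.
case: (mxP M) => [[sub M0 add mul] _ _]; split=> // x y Mx My.
by apply: add; rewrite // -mulN1r; apply: mxMl; rewrite // rpredN rpred1.
Qed.
HB.instance Definition _ M := GRing.isZmodClosed.Build L (mx_pred M) (@mx_zmod M).

Lemma mxN1 M : 1 \notin M.
Proof. by case: (mxP M) => [_ /negP]. Qed.

(** Zorn's lemma is applied to the sets whose union with [I] is a proper ideal, rather than to
    ideals containing [I]. The empty chain then needs no separate case, since its union gives [I]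
    itself. *)
Lemma ideal_maxspec (I : L -> Prop) : ideal_of V I -> ~ I 1 ->
  exists M, forall x, I x -> x \in M.
Proof.
move=> [Isub I0 Iadd Imul] I1.
pose P (A : set L) := let J := (fun x => A x \/ I x) in ideal_of V J /\ ~ J 1.
have [|A [[Aid A1] Amax]] := @Zorn_bigcup L P.
- move=> C CP Ctot; rewrite /P; set J := fun x => _.
  have chain2 x y : J x -> J y -> (exists2 X, C X & [/\ X x \/ I x & X y \/ I y]) \/ (I x /\ I y).
    move=> [[X CX Xx]|Ix] [[Y CY Yy]|Iy]; last by right.
    - left; case: (Ctot _ _ CX CY) => [XY|YX].
        by exists Y => //; split; left; [apply: XY|].
      by exists X => //; split; left; [|apply: YX].
    - by left; exists X => //; split; [left|right].
    - by left; exists Y => //; split; [right|left].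
  have inJ X x : C X -> X x \/ I x -> J x.
    by move=> CX [Xx|Ix]; [left; exists X|right].
  split; last first.
    move=> [[X CX X1]|//]; case: (CP _ CX) => _; apply; by left.
  split.
  + move=> x [[X CX Xx]|/Isub//].
    by case: (CP _ CX) => [[sub _ _ _] _]; apply: sub; left.
  + by right.
  + move=> x y Jx Jy; have [[X CX [Xx Xy]]|[Ix Iy]] := chain2 _ _ Jx Jy; last by right; apply: Iadd.
    by apply: (inJ X) => //; case: (CP _ CX) => [[_ _ add _] _]; apply: add.
  + move=> s x Ss Jx; have [[X CX [Xx _]]|[Ix _]] := chain2 _ _ Jx Jx; last by right; apply: Imul.
    by apply: (inJ X) => //; case: (CP _ CX) => [[_ _ _ mul] _]; apply: mul.
- pose N x := A x \/ I x.
  suff HN : max_ideal V N.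
    by exists (maxspec_of HN) => x Ix; rewrite maxspec_ofE; apply/asboolP; right.
  split=> // J Jid J1 NJ x Jx; apply: contrapT => nNx.
  apply: (Amax J); last first.
    suff E : (fun x => J x \/ I x) = J by rewrite /P E; split=> // -[].
    apply/funext=> y; apply/propext; split=> [[//|Iy]|]; last by left.
    by apply: NJ; right.
  split; last by move=> /(_ _ Jx) Ax; apply: nNx; left.
  by move=> y Ay; apply: NJ; left.
Qed.

Lemma mx_inv M c : c \in S -> c \notin M -> exists2 c', c' \in S & c * c' - 1 \in M.
Proof.
move=> Sc nMc; pose I x := exists s, s \in S /\ x - c * s \in M.
have [I1|nI1] := pselect (I 1).
  by have [s [Ss Ms]] := I1; exists s => //; rewrite -opprB rpredN.
case: (mxP M) => _ _ /(_ I) maxM; case/negP: nMc; apply: maxM => //.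
- split=> [x [s [Ss Ms]]||x y [s [Ss Ms]] [t [St Mt]]|t x St [s [Ss Ms]]].
  + by apply/sringP; rewrite -(subrK (c * s) x) rpredD ?rpredM // (mx_sub Ms).
  + by exists 0; rewrite rpred0 mulr0 subr0 rpred0.
  + exists (s + t); split; first exact: rpredD.
    by rewrite mulrDr opprD addrACA rpredD.
  + move/sringP in St; exists (t * s); split; first exact: rpredM.
    by rewrite mulrCA -mulrBr mxMl.
- by move=> x Mx; exists 0; rewrite rpred0 mulr0 subr0.
- by exists 1; rewrite rpred1 mulr1 subrr rpred0.
Qed.

Lemma mx_prime M x y : x \in S -> y \in S -> x * y \in M -> (x \in M) || (y \in M).
Proof.
move=> Sx Sy Mxy; case: (boolP (x \in M)) => //= nMx.
have [x' Sx' Mx'] := mx_inv Sx nMx.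
rewrite (_ : y = x' * (x * y) - (x * x' - 1) * y); last by ring.
by apply: rpredB; [apply: mxMl | apply: mxMr].
Qed.

Lemma mxMn M x y : x \in S -> y \in S -> x \notin M -> y \notin M -> x * y \notin M.
Proof. by move=> Sx Sy nx ny; apply/negP=> /(mx_prime Sx Sy); rewrite (negPf nx) (negPf ny). Qed.

Lemma mx_prodn M (I : finType) (P : pred I) (x : I -> L) :
  (forall i, P i -> x i \in S) -> (forall i, P i -> x i \notin M) ->
  \prod_(i | P i) x i \notin M.
Proof.
move=> Sx nx; suff: (\prod_(i | P i) x i \in S) && (\prod_(i | P i) x i \notin M) by case/andP.
apply: (big_ind (fun y => (y \in S) && (y \notin M))) => [|y z|i Pi].
- by rewrite rpred1 mxN1.
- by move=> /andP[? ?] /andP[? ?]; rewrite rpredM ?mxMn.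
- by rewrite Sx ?nx.
Qed.

Lemma mx_max M M' : {subset M <= M'} -> M =i M'.
Proof.
move=> sub x; apply/idP/idP; first exact: sub.
case: (mxP M) => _ _ /(_ (fun x => x \in M')); apply=> //.
  by case: (mxP M').
exact/negP/mxN1.
Qed.

Lemma mx_comax M M' : ~ (M =i M') -> exists2 a, a \in M & 1 - a \in M'.
Proof.
move=> neq; have [x M'x nMx] : exists2 x, x \in M' & x \notin M.
  apply: contrapT => no; apply: neq => x; apply/esym; move: x; apply: mx_max => x M'x.
  by apply: contraT => nMx; case: no; exists x.
have [x' Sx' Mx'] := mx_inv (mx_sub M'x) nMx.
by exists (1 - x * x'); [rewrite -opprB rpredN | rewrite subKr mxMr].
Qed.

Lemma prod_sub1 M (I : finType) (P : pred I) (x : I -> L) :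
  (forall i, P i -> x i - 1 \in M) -> \prod_(i | P i) x i - 1 \in M.
Proof.
move=> Mx; apply: (big_ind (fun y => y - 1 \in M)) => [|y z My Mz|i /Mx//].
  by rewrite subrr rpred0.
have Sz : z \in S by rewrite -(subrK 1 z) rpredD ?rpred1 // (mx_sub Mz).
by rewrite (_ : y * z - 1 = (y - 1) * z + (z - 1)); [rewrite rpredD ?mxMr | ring].
Qed.

(** Lying over, through a norm. If [c] were in the maximal ideal of [V] but invertible modulo [M],
    some [x = 1 - c * s] would be in [M]; its norm is in [M], yet it is congruent to 1 modulo [c]
    and so a unit of [V]. *)
Lemma mx_vmax M c : (c%:A \in M) = (c \in vmax V).
Proof.
apply/idP/idP => [Mc|mc].
  have Vc : c \in vring V by rewrite -sring_in_alg (mx_sub Mc).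
  apply: contraT => nmc; have [c0 Vc'] := vunit_inv Vc nmc.
  have := mxN1 M; rewrite -(scale1r 1) -(mulfV c0) in_algM mxMr //.
  by rewrite sring_in_alg.
have [-> | c0] := eqVneq c 0; first by rewrite scale0r rpred0.
have Vc := vmax_sub mc; have Sc : c%:A \in S by rewrite sring_in_alg.
apply: contraT => nMc; have [s Ss Ms] := mx_inv Sc nMc.
pose x := 1 - c%:A * s; have Mx : x \in M by rewrite -rpredN /x opprB.
have [v Nv] := norm_exists V x.
have Mv : v%:A \in M.
  rewrite -Nv (bigD1 1%g) //= gal1f mxMr // rpred_prod // => t _.
  by rewrite sring_gal (mx_sub Mx).
have Vv : v \in vring V by rewrite -sring_in_alg (mx_sub Mv).
have [w Sw vE] : exists2 w, w \in S & v%:A = 1 + c%:A * w.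
  rewrite -Nv; apply: (big_ind (fun y => exists2 w, w \in S & y = 1 + c%:A * w)).
  - by exists 0; rewrite ?rpred0 // mulr0 addr0.
  - move=> y z [w Sw ->] [w' Sw' ->]; exists (w + w' + c%:A * w * w').
      by rewrite !rpredD ?rpredM.
    by ring.
  - move=> t _; exists (- t s); first by rewrite rpredN sring_gal.
    by rewrite rmorphB rmorphM rmorph1 /= gal_in_alg mulrN.
have V1v : (v - 1) / c \in vring V.
  rewrite -sring_in_alg in_algM in_algB in_algV vE scale1r addrC addKr.
  by rewrite mulrAC divff ?mul1r ?in_alg_eq0.
have m1v : v - 1 \in vmax V by rewrite -(divfK c0 (v - 1)) vmaxMl.
have [|v0 Vv'] := @vunit_inv _ _ V v Vv.
  by apply: contra (vmaxN1 V) => mv; rewrite -(subKr v 1) rpredB.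
have := mxN1 M; rewrite -(scale1r 1) -(mulfV v0) in_algM mxMr //.
by rewrite sring_in_alg.
Qed.

Lemma mxpre_max M (s : G) : max_ideal V (fun x => s x \in M).
Proof.
split=> [||I [Isub I0 Iadd Imul] I1 MI x Ix].
- split=> [x Mx||x y Mx My|t x /sringP St Mx].
  + by apply/sringP; rewrite -(sring_gal V s) (mx_sub Mx).
  + by rewrite rmorph0 rpred0.
  + by rewrite rmorphD rpredD.
  + by rewrite rmorphM mxMl // sring_gal.
- by rewrite rmorph1; apply/negP/mxN1.
case: (mxP M) => _ _ /(_ (fun x => I ((s^-1)%g x))); apply.
- split=> [y /Isub/sringP||y z Iy Iz|t y /sringP St Iy].
  + by rewrite sring_gal => /sringP.
  + by rewrite rmorph0.
  + by rewrite rmorphD; apply: Iadd.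
  + by rewrite rmorphM; apply: Imul => //; apply/sringP; rewrite sring_gal.
- by rewrite rmorph1.
- by move=> y My; apply: MI; rewrite galKV.
- by rewrite galVK.
Qed.

(* The conjugate [s^-1 M]. *)
Definition mxpre M (s : G) : maxspec V := MaxSpec (mxpre_max M s).

Lemma mxpreE M s x : (x \in mxpre M s) = (s x \in M).
Proof. by []. Qed.

Definition loc M : {pred L} := fun x => `[< locS V (fun y => y \in M) x >].
Definition locm M : {pred L} := fun x => `[< locM V (fun y => y \in M) x >].

Lemma locP M x :
  reflect (exists a b, [/\ a \in S, b \in S, b \notin M & x = a / b]) (x \in loc M).
Proof.
apply: (iffP (asboolP _)) => [[a [b [/sringP Sa /sringP Sb /negP Mb ->]]]|].
  by exists a, b.
by move=> [a [b [/sringP Sa /sringP Sb /negP Mb ->]]]; exists a, b.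
Qed.

Lemma locmP M x :
  reflect (exists a b, [/\ a \in M, b \in S, b \notin M & x = a / b]) (x \in locm M).
Proof.
apply: (iffP (asboolP _)) => [[a [b [Sa /sringP Sb /negP Mb ->]]]|].
  by exists a, b.
by move=> [a [b [Sa /sringP Sb /negP Mb ->]]]; exists a, b.
Qed.

Lemma nmx_neq0 M b : b \notin M -> b != 0.
Proof. by apply: contraNneq => ->; rewrite rpred0. Qed.

Lemma loc_subring M : subring_closed (loc M).
Proof.
split=> [|_ _ /locP[a [b [Sa Sb Mb ->]]] /locP[c [d [Sc Sd Md ->]]]|
          _ _ /locP[a [b [Sa Sb Mb ->]]] /locP[c [d [Sc Sd Md ->]]]]; apply/locP.
- by exists 1, 1; rewrite rpred1 mxN1 divr1.
- have b0 := nmx_neq0 Mb; have d0 := nmx_neq0 Md.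
  exists (a * d - c * b), (b * d); split; rewrite ?rpredB ?rpredM ?mxMn //.
  by field; rewrite b0 d0.
- by exists (a * c), (b * d); split; rewrite ?rpredM ?mxMn // mulf_div.
Qed.
HB.instance Definition _ M := GRing.isSubringClosed.Build L (loc M) (@loc_subring M).

Lemma locmMl M x y : x \in loc M -> y \in locm M -> x * y \in locm M.
Proof.
move=> /locP[a [b [Sa Sb Mb ->]]] /locmP[c [d [Sc Sd Md ->]]]; apply/locmP.
by exists (a * c), (b * d); split; rewrite ?rpredM ?mxMn ?mxMl // mulf_div.
Qed.

Lemma locm_zmod M : zmod_closed (locm M).
Proof.
split=> [|_ _ /locmP[a [b [Ma Sb Mb ->]]] /locmP[c [d [Mc Sd Md ->]]]]; apply/locmP.
  by exists 0, 1; rewrite rpred1 rpred0 mxN1 mul0r.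
have b0 := nmx_neq0 Mb; have d0 := nmx_neq0 Md.
exists (a * d - c * b), (b * d); split; rewrite ?rpredB ?rpredM ?mxMn ?mxMr //.
by field; rewrite b0 d0.
Qed.
HB.instance Definition _ M := GRing.isZmodClosed.Build L (locm M) (@locm_zmod M).

Lemma sring_loc M x : x \in S -> x \in loc M.
Proof. by move=> Sx; apply/locP; exists x, 1; rewrite rpred1 mxN1 divr1. Qed.

Lemma mx_locm M x : x \in M -> x \in locm M.
Proof. by move=> Mx; apply/locmP; exists x, 1; rewrite rpred1 mxN1 divr1. Qed.

Lemma locm_mx M x : x \in S -> (x \in locm M) = (x \in M).
Proof.
move=> Sx; apply/idP/idP => [/locmP[a [b [Ma Sb Mb xE]]]|]; last exact: mx_locm.
have : x * b \in M by rewrite xE divfK ?(nmx_neq0 Mb).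
by case/(mx_prime Sx Sb)/orP => //; rewrite (negPf Mb).
Qed.

Lemma locmN1 M : 1 \notin locm M.
Proof. by rewrite locm_mx ?rpred1 ?mxN1. Qed.

Lemma locm_sub M x : x \in locm M -> x \in loc M.
Proof.
by move=> /locmP[a [b [Ma Sb Mb ->]]]; apply/locP; exists a, b; rewrite (mx_sub Ma).
Qed.

(** Replace [1 / b] by an inverse of [b] modulo [M]. Residue computations can thus be carried out in
    [S]. *)
Lemma loc_residue M x : x \in loc M -> exists2 s, s \in S & x - s \in locm M.
Proof.
move=> /locP[a [b [Sa Sb Mb ->]]]; have [c Sc Mc] := mx_inv Sb Mb.
exists (a * c); rewrite ?rpredM //; have b0 := nmx_neq0 Mb.
apply/locmP; exists (- a * (b * c - 1)), b; split; rewrite ?mxMl ?rpredN //.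
by field.
Qed.

Lemma loc_unit M x : x \in loc M -> x \notin locm M -> x != 0 /\ x^-1 \in loc M.
Proof.
move=> /locP[a [b [Sa Sb Mb ->]]] nx.
have nMa : a \notin M by apply: contra nx => Ma; apply/locmP; exists a, b.
rewrite mulf_neq0 ?invr_eq0 ?(nmx_neq0 nMa) ?(nmx_neq0 Mb) //; split=> //.
by apply/locP; exists b, a; rewrite invf_div.
Qed.

Lemma unit_nlocm M x : x != 0 -> x^-1 \in loc M -> x \notin locm M.
Proof.
by move=> x0 Vx; apply: contra (locmN1 M) => /(locmMl Vx); rewrite mulVf.
Qed.

Lemma unit_locSP M x :
  unit_locS V (fun y => y \in M) x <-> [/\ x \in loc M, x != 0 & x^-1 \in loc M].
Proof. by split=> [] [/asboolP ? ? /asboolP ?]; split=> //; apply/asboolP. Qed.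

Lemma mx_crt (I : finType) (M : I -> maxspec V) (i : I) :
  (forall j, j != i -> ~ (M j =i M i)) ->
  exists2 e, e \in S & e - 1 \in M i /\ forall j, j != i -> e \in M j.
Proof.
move=> dis; have /choice[a aP] : forall j, exists a, j != i -> a \in M j /\ 1 - a \in M i.
  move=> j; case: (eqVneq j i) => [_|/dis/mx_comax[a ? ?]]; first by exists 0.
  by exists a.
have Sa j : j != i -> a j \in S by move=> /aP[/mx_sub].
exists (\prod_(j | j != i) a j); first exact: rpred_prod.
split=> [|j ji].
  by apply: prod_sub1 => j /aP[_]; rewrite -opprB rpredN.
rewrite (bigD1 j) //= mxMr ?rpred_prod //; last by have [] := aP _ ji.
by move=> k /andP[ki _]; apply: Sa.
Qed.

End MaximalIdeals.

(** * Galois coordinate systems and trace-dual bases *)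

Section GaloisSystem.
Variables (F : fieldType) (L : splittingFieldType F) (V : galval L).
Local Notation G := (galT L).
Local Notation S := (sring V).

(** The Chase-Harrison-Rosenberg criterion for a Galois extension of rings: the tensor
    [sum x_i (x) y_i] maps to the idempotent of the identity in the product of copies of [S] indexed
    by [G]. *)
Definition galois_system (I : finType) (x y : I -> L) :=
  [/\ forall i, x i \in S, forall i, y i \in S &
      forall s : G, \sum_i x i * s (y i) = (s == 1%g)%:R].

Lemma galois_system_expand (I : finType) (x y : I -> L) z :
  galois_system x y -> z = \sum_i (trF V (z * y i))%:A * x i.
Proof.
move=> [_ _ xy]; transitivity (\sum_(s : G) s z * \sum_i x i * s (y i)).
  rewrite (bigD1 1%g) //= xy eqxx mulr1 gal1f big1 ?addr0 // => s s1.
  by rewrite xy (negPf s1) mulr0.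
under eq_bigr => s _ do rewrite mulr_sumr.
rewrite exchange_big /=; apply: eq_bigr => i _.
rewrite trFE mulr_suml; apply: eq_bigr => s _.
by rewrite rmorphM; ring.
Qed.

Lemma galois_system_ord (I : finType) (x y : I -> L) : galois_system x y ->
  exists n (x' y' : 'I_n -> L), galois_system x' y'.
Proof.
move=> [Sx Sy xy]; exists #|I|, (x \o enum_val), (y \o enum_val); split=> [i|i|s] /=; rewrite ?Sx ?Sy //.
by rewrite -xy -(big_enum_val (A := I) (fun i => x i * s (y i))).
Qed.

(** Take a system of minimal length. A relation among the [x i], divided by its coefficient of least
    value, expresses [x k] over [V] through the others, and [x k] can be eliminated. *)
Lemma galois_system_free (I : finType) (x y : I -> L) : galois_system x y ->
  exists n (x' y' : 'I_n -> L), galois_system x' y' /\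
  forall c : 'I_n -> F, \sum_i (c i)%:A * x' i = 0 -> forall i, c i = 0.
Proof.
move=> /galois_system_ord[n0 GS0].
pose P n := `[< exists x' y' : 'I_n -> L, galois_system x' y' >].
have exP : exists n, P n by exists n0; apply/asboolP.
have [n /asboolP[{}x [{}y GS]] n_min] := ex_minnP exP.
exists n, x, y; split=> // c cx0 i; apply/eqP; apply: contraT => ci0.
have [k ck Vk] := @vring_min_val _ _ V _ c i ci0.
case: n => [|n] in x y GS n_min c cx0 i ci0 k ck Vk *; first by case: i ci0.
have [Sx Sy xy] := GS.
suff : P n by move/n_min; rewrite ltnn.
apply/asboolP; exists (fun i => x (lift k i)).
(* The correction of [y] absorbs the eliminated term. Its coefficients lie in [F], hence are fixed
   by every [s], and the sums for all [s] are preserved at once. *)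
exists (fun i => y (lift k i) - (c (lift k i) / c k)%:A * y k).
split=> [j|j|s]; first exact: Sx.
  by rewrite rpredB ?rpredM ?sring_in_alg.
rewrite -xy [RHS](bigD1_ord k) //=.
have xk : x k = - \sum_j (c (lift k j) / c k)%:A * x (lift k j).
  move: cx0; rewrite (bigD1_ord k) //= => /eqP; rewrite addr_eq0 => /eqP cxk.
  apply: (mulfI (_ : (c k)%:A != 0)); first by rewrite in_alg_eq0.
  rewrite cxk mulrN mulr_sumr; congr (- _); apply: eq_bigr => j _.
  by rewrite mulrA -in_algM [c k * _]mulrC divfK.
rewrite {1}xk mulNr mulr_suml addrC -sumrB; apply: eq_bigr => j _.
by rewrite rmorphB rmorphM /= gal_in_alg; ring.
Qed.

Lemma galois_system_dual n (x y : 'I_n -> L) : galois_system x y ->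
  (forall c : 'I_n -> F, \sum_i (c i)%:A * x i = 0 -> forall i, c i = 0) ->
  forall i j, trF V (x j * y i) = (i == j)%:R.
Proof.
move=> GS free i j; apply/eqP; rewrite -subr_eq0; apply/eqP.
apply: (free (fun i => trF V (x j * y i) - (i == j)%:R)).
under eq_bigr => k _ do rewrite in_algB mulrBl.
rewrite sumrB -(galois_system_expand (x j) GS) (bigD1 j) //= eqxx scale1r mul1r big1 ?addr0 ?subrr //.
by move=> k kj; rewrite (negPf kj) scale0r mul0r.
Qed.

End GaloisSystem.

(** * The crossed product, and what the Azumaya property implies *)

Section CrossedProduct.
Variables (F : fieldType) (L : splittingFieldType F) (V : galval L).
Local Notation G := (galT L).
Local Notation S := (sring V).
Variable f : G -> G -> L.

(* The element [a x_s] of [A_f]. *)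
Definition xel (a : L) (s : G) : crossT L := [ffun r => if r == s then a else 0].

Local Notation "a ** b" := (Defs.mulA f a b) (at level 40, left associativity).

(** The library composes [G] from left to right, so [gcomp s^-1 r] is [r * s^-1]. For the same
    reason [x_s x_t] has index [t * s] below. *)
Lemma mulAE (a b : crossT L) r :
  (a ** b) r = \sum_(s : G) a s * s (b (r * s^-1)%g) * f s (r * s^-1)%g.
Proof. by rewrite ffunE. Qed.

Lemma xelE a s r : xel a s r = if r == s then a else 0.
Proof. by rewrite ffunE. Qed.

Lemma mul_xel (a : L) s (b : crossT L) r :
  (xel a s ** b) r = a * s (b (r * s^-1)%g) * f s (r * s^-1)%g.
Proof.
rewrite mulAE (bigD1 s) //= xelE eqxx big1 ?addr0 // => t ts.
by rewrite xelE (negPf ts) !mul0r.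
Qed.

Lemma mul_xelr (a : L) t (b : crossT L) r :
  (b ** xel a t) r = b (t^-1 * r)%g * (t^-1 * r)%g a * f (t^-1 * r)%g t.
Proof.
have E : (r * (t^-1 * r)^-1 = t)%g by rewrite invMg invgK mulgA mulgV mul1g.
rewrite mulAE (bigD1 (t^-1 * r)%g) //= E xelE eqxx big1 ?addr0 // => s st.
rewrite xelE ifN ?rmorph0 ?mulr0 ?mul0r //.
by apply: contraNneq st => <-; rewrite invMg invgK -mulgA mulVg mulg1.
Qed.

Lemma mul_xel_xel a s b t : xel a s ** xel b t = xel (a * s b * f s t) (t * s)%g.
Proof.
apply/ffunP=> r; rewrite mul_xel !xelE.
have -> : (r * s^-1 == t)%g = (r == t * s)%g.
  by rewrite -(inj_eq (mulIg s)) mulgKV.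
by case: eqP => [->|_]; rewrite ?mulgK // rmorph0 mulr0 mul0r.
Qed.

Lemma scaleAE v (a : crossT L) r : scaleA v a r = v%:A * a r.
Proof. by rewrite ffunE. Qed.

Lemma crossT_sumE (I : finType) (a : I -> crossT L) r : (\sum_i a i) r = \sum_i a i r.
Proof. exact: sum_ffunE. Qed.

Lemma mulA_suml (I : finType) (a : I -> crossT L) b :
  (\sum_i a i) ** b = \sum_i a i ** b.
Proof.
apply/ffunP=> r; rewrite mulAE crossT_sumE; under [RHS]eq_bigr do rewrite mulAE.
rewrite exchange_big /=; apply: eq_bigr => s _.
by rewrite crossT_sumE !mulr_suml.
Qed.

Lemma mulA_sumr (I : finType) (b : I -> crossT L) a :
  a ** (\sum_i b i) = \sum_i a ** b i.
Proof.
apply/ffunP=> r; rewrite mulAE crossT_sumE; under [RHS]eq_bigr do rewrite mulAE.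
rewrite exchange_big /=; apply: eq_bigr => s _.
by rewrite crossT_sumE rmorph_sum mulr_sumr mulr_suml.
Qed.

Lemma mulA_scalel v a b : scaleA v a ** b = scaleA v (a ** b).
Proof.
apply/ffunP=> r; rewrite scaleAE !mulAE mulr_sumr; apply: eq_bigr => s _.
by rewrite scaleAE !mulrA.
Qed.

Lemma mulA_scaler v a b : a ** scaleA v b = scaleA v (a ** b).
Proof.
apply/ffunP=> r; rewrite scaleAE !mulAE mulr_sumr; apply: eq_bigr => s _.
by rewrite scaleAE rmorphM /= gal_in_alg; ring.
Qed.

Lemma scaleA_suml (I : finType) (v : I -> F) (a : crossT L) :
  scaleA (\sum_i v i) a = \sum_i scaleA (v i) a.
Proof.
apply/ffunP=> r; rewrite scaleAE !crossT_sumE scaler_suml mulr_suml.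
by apply: eq_bigr => i _; rewrite scaleAE.
Qed.

Lemma scaleA_scale u v (a : crossT L) : scaleA u (scaleA v a) = scaleA (u * v) a.
Proof. by apply/ffunP=> r; rewrite !scaleAE in_algM mulrA. Qed.

Lemma scaleA_xel v a s : scaleA v (xel a s) = xel (v%:A * a) s.
Proof. by apply/ffunP=> r; rewrite scaleAE !xelE; case: eqP; rewrite ?mulr0. Qed.

Lemma xel_sum (I : finType) (a : I -> L) s : xel (\sum_i a i) s = \sum_i xel (a i) s.
Proof.
apply/ffunP=> r; rewrite xelE crossT_sumE; case: (eqVneq r s) => [->|rs].
  by apply: eq_bigr => i _; rewrite xelE eqxx.
by rewrite big1 // => i _; rewrite xelE (negPf rs).
Qed.

(** Reindexing by [s -> t * s] makes the twist of [z] the summation variable, which presents the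
    coefficient as a combination of the conjugates [s z], ready for Dedekind independence. *)
Lemma sandwich_coef p q z t r : (p ** xel z t ** q) r =
  \sum_(s : G) p s * f s t * (t * s)%g (q (r * (t * s)^-1)%g)
     * f (t * s)%g (r * (t * s)^-1)%g * s z.
Proof.
rewrite mulAE (reindex_inj (mulgI t)) /=; apply: eq_bigr => s _.
by rewrite mul_xelr mulKg; ring.
Qed.

Lemma inAP a : inA V a <-> forall s, a s \in S.
Proof. by split=> Sa s; apply/sringP. Qed.

Lemma inA_xel a s : a \in S -> inA V (xel a s).
Proof. by move=> Sa; apply/inAP=> r; rewrite xelE; case: eqP; rewrite ?rpred0. Qed.

Hypothesis f_cocycle : normalized_cocycle V f.

Lemma cocycle_sring s t : f s t \in S.
Proof. by case: f_cocycle => /(_ s t)[/sringP]. Qed.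

Lemma cocycle_neq0 s t : f s t != 0.
Proof. by case: f_cocycle => /(_ s t)[]. Qed.

Lemma cocycle1l s : f 1%g s = 1. Proof. by case: f_cocycle => _ _ /(_ s)[]. Qed.
Lemma cocycle1r s : f s 1%g = 1. Proof. by case: f_cocycle => _ _ /(_ s)[]. Qed.

Lemma mulAA a b c : a ** b ** c = a ** (b ** c).
Proof.
apply/ffunP=> r; rewrite !mulAE.
under eq_bigr => u _ do rewrite mulAE !mulr_suml.
rewrite exchange_big /=; apply: eq_bigr => s _.
rewrite mulAE rmorph_sum mulr_sumr mulr_suml /=.
rewrite (reindex_inj (mulIg s)) /=; apply: eq_bigr => t _.
have -> : (r * (t * s)^-1 = r * s^-1 * t^-1)%g by rewrite invMg mulgA.
rewrite mulgK !rmorphM galMf; case: f_cocycle => _ /(_ s t (r * s^-1 * t^-1)%g) + _.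
rewrite /gcomp mulgKV => E.
transitivity (a s * s (b t) * s (t (c (r * s^-1 * t^-1)%g)) *
  (f s t * f (t * s)%g (r * s^-1 * t^-1)%g)); first by ring.
by rewrite -E; ring.
Qed.

Lemma inA_mul a b : inA V a -> inA V b -> inA V (a ** b).
Proof.
move=> /inAP Sa /inAP Sb; apply/inAP => r; rewrite mulAE rpred_sum // => s _.
by rewrite !rpredM ?sring_gal ?cocycle_sring.
Qed.

(** Dedekind independence on [S] identifies the coefficients of each [s z]. The gain is that [k s]
    becomes a product of two cocycle values with an element of [S]. *)
Lemma azumaya_sandwich N (b : 'I_N -> crossT L) (c : 'I_N -> 'I_N -> F)
    (phi : crossT L -> crossT L) t r :
  (forall x, inA V x -> phi x = \sum_i \sum_j scaleA (c i j) (b i ** x ** b j)) ->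
  forall k : G -> L, (forall z, z \in S -> phi (xel z t) r = \sum_(s : G) k s * s z) ->
  forall s, k s = f s t * f (t * s)%g (r * (t * s)^-1)%g *
    \sum_i \sum_j (c i j)%:A * (b i s * (t * s)%g (b j (r * (t * s)^-1)%g)).
Proof.
move=> phiE k kE s; apply/eqP; rewrite -subr_eq0; apply/eqP; move: s.
apply: (@dedekind_sring _ _ V) => z Sz.
under eq_bigr => s _ do rewrite mulrBl.
rewrite sumrB -kE // phiE; last exact: inA_xel.
rewrite crossT_sumE; apply/eqP; rewrite subr_eq0; apply/eqP.
under [LHS]eq_bigr => i _ do rewrite crossT_sumE.
under [LHS]eq_bigr => i _ do under eq_bigr => j _ do rewrite scaleAE sandwich_coef mulr_sumr.
under [RHS]eq_bigr => s _ do rewrite mulr_sumr mulr_suml.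
rewrite [RHS]exchange_big /=; apply: eq_bigr => i _.
under [RHS]eq_bigr => s _ do rewrite mulr_sumr mulr_suml.
rewrite [RHS]exchange_big /=; apply: eq_bigr => j _.
by apply: eq_bigr => s _; ring.
Qed.

Lemma azumaya_units_galois_system : azumaya V f ->
  (forall s : G, unitS V (f s s^-1%g)) /\
  exists (I : finType) (x y : I -> L), galois_system V x y.
Proof.
move=> [N [b [bA _ _ _ sand]]].
have Sb i s : b i s \in S by move: s; apply/inAP.
(* The map [sum a_s x_s -> t (a_1) x_1]. On [z x_1] its coefficient at 1 is [t z]; comparing the
   coefficients of that conjugate makes 1 a multiple of [f t t^-1] in [S]. *)
pose phi (t : G) (a : crossT L) := xel (t (a 1%g)) 1%g.
have phiA t a : inA V a -> inA V (phi t a).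
  by move=> /inAP Sa; apply: inA_xel; rewrite sring_gal.
have phiL t v w a a' : V v -> V w -> inA V a -> inA V a' ->
    phi t (scaleA v a + scaleA w a') = scaleA v (phi t a) + scaleA w (phi t a').
  move=> _ _ _ _; apply/ffunP=> r; rewrite !ffunE; case: eqP => _; last by rewrite !mulr0 addr0.
  by rewrite rmorphD !rmorphM /= !gal_in_alg.
split=> [s|].
  have [c [Vc phiE _]] := sand _ (phiA s) (phiL s).
  have := azumaya_sandwich phiE (k := fun u => (u == s)%:R) (t := 1%g) (r := 1%g).
  move=> /(_ _ s) /=; rewrite eqxx !mul1g cocycle1r mul1r => E.
  set w := \sum_i _ in E.
  have Sw : w \in S.
    apply: rpred_sum => i _; apply: rpred_sum => j _.
    by rewrite !rpredM ?sring_in_alg ?sring_gal //; apply/vringP.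
  have {}E : 1 = f s s^-1%g * w.
    apply: E => z Sz; rewrite /phi !xelE eqxx (bigD1 s) //= eqxx mul1r big1 ?addr0 //.
    by move=> u us; rewrite (negPf us) mul0r.
  split; rewrite ?cocycle_neq0 //; first exact/sringP/cocycle_sring.
  apply/sringP; rewrite (_ : _^-1 = w) //.
  by apply: (mulfI (cocycle_neq0 s s^-1%g)); rewrite -E divff ?cocycle_neq0.
(* Now the projection to [S x_1] is evaluated on [z x_t], at index [t]. In the coefficient of [z]
   itself the cocycle factors are [f 1 t] and [f t 1], both 1, so what remains is the sum required
   of a Galois system. *)
have [c [Vc phiE _]] := sand _ (phiA 1%g) (phiL 1%g).
exists ('I_N * 'I_N)%type, (fun ij => (c ij.1 ij.2)%:A * b ij.1 1%g), (fun ij => b ij.2 1%g).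
split=> [[i j]|[i j]|t] //=; first by rewrite rpredM // sring_in_alg; apply/vringP.
have := azumaya_sandwich phiE (k := fun u => (t == 1%g)%:R * (u == 1%g)%:R) (t := t) (r := t).
move=> /(_ _ 1%g) /=; rewrite eqxx mulr1 mulg1 mulgV cocycle1l cocycle1r !mul1r => ->.
  by rewrite pair_big /=; apply: eq_bigr => ij _; rewrite mulrA.
move=> z Sz; rewrite /phi !xelE (bigD1 1%g) //= eqxx gal1f big1 ?addr0.
  by rewrite eq_sym; case: eqP; rewrite gal1f ?mul0r ?mulr1 ?mul1r.
by move=> u u1; rewrite (negPf u1) mulr0 mul0r.
Qed.

End CrossedProduct.

Lemma sum_pair (R : nmodType) (I J : finType) (g : I * J -> R) :
  \sum_k g k = \sum_i \sum_j g (i, j).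
Proof. by rewrite pair_bigA; apply: eq_bigr => -[]. Qed.

(** * From a Galois system to the Azumaya property *)

Section AzumayaOfGalois.
Variables (F : fieldType) (L : splittingFieldType F) (V : galval L).
Local Notation G := (galT L).
Local Notation S := (sring V).
Variable f : G -> G -> L.
Local Notation "a ** b" := (Defs.mulA f a b) (at level 40, left associativity).

(** Adapts the definition to a basis indexed by [G * 'I_n] and turns uniqueness of the sandwich
    coefficients into injectivity, by subtraction. *)
Lemma azumaya_finType (I : finType) (b : I -> crossT L) :
  (forall i, inA V (b i)) ->
  (forall a : crossT L, inA V a -> exists c : I -> F,
     (forall i, V (c i)) /\ a = \sum_i scaleA (c i) (b i)) ->
  (forall c : I -> F, \sum_i scaleA (c i) (b i) = 0 -> forall i, c i = 0) ->
  (forall v, V v -> (forall a : crossT L, inA V a -> scaleA v a = 0) -> v = 0) ->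
  (forall phi : crossT L -> crossT L,
     (forall a, inA V a -> inA V (phi a)) ->
     (forall v w a a', V v -> V w -> inA V a -> inA V a' ->
        phi (scaleA v a + scaleA w a') = scaleA v (phi a) + scaleA w (phi a')) ->
     exists c : I -> I -> F, (forall i j, V (c i j)) /\
       forall x, inA V x -> phi x = \sum_i \sum_j scaleA (c i j) (b i ** x ** b j)) ->
  (forall c : I -> I -> F,
     (forall x, inA V x -> \sum_i \sum_j scaleA (c i j) (b i ** x ** b j) = 0) ->
     forall i j, c i j = 0) ->
  azumaya V f.
Proof.
move=> bA gen free faith sand uniq.
have ev (g : I -> crossT L) : \sum_(i < #|I|) g (enum_val i) = \sum_i g i.
  by rewrite -(big_enum_val (A := I) g).
exists #|I|, (fun i => b (enum_val i)); split=> //.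
- move=> a /gen[c [Vc aE]]; exists (fun i => c (enum_val i)); split=> //.
  by rewrite (ev (fun i => scaleA (c i) (b i))).
- move=> c Vc c0 i; have := free (c \o enum_rank) _ (enum_val i).
  rewrite /= enum_valK; apply; rewrite -ev /= -[RHS]c0.
  by apply: eq_bigr => j _; rewrite enum_valK.
move=> phi phiA phiL; have [c [Vc cE]] := sand phi phiA phiL.
have ev2 (d : I -> I -> F) x :
    \sum_(i < #|I|) \sum_(j < #|I|) scaleA (d (enum_val i) (enum_val j))
      (b (enum_val i) ** x ** b (enum_val j)) =
    \sum_i \sum_j scaleA (d i j) (b i ** x ** b j).
  rewrite -[RHS](ev (fun i => \sum_j scaleA (d i j) (b i ** x ** b j))).
  apply: eq_bigr => i _.
  by rewrite -(ev (fun j => scaleA (d (enum_val i) j) (b (enum_val i) ** x ** b j))).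
exists (fun i j => c (enum_val i) (enum_val j)); split=> //.
  by move=> x Ax; rewrite cE // ev2.
move=> c' Vc' c'E; apply/funext=> i; apply/funext=> j; apply/eqP; rewrite -subr_eq0; apply/eqP.
have := uniq (fun i j => c' (enum_rank i) (enum_rank j) - c i j) _ (enum_val i) (enum_val j).
rewrite !enum_valK; apply=> x Ax; apply/eqP.
have -> : \sum_i \sum_j scaleA (c' (enum_rank i) (enum_rank j) - c i j) (b i ** x ** b j) =
  \sum_i \sum_j scaleA (c' (enum_rank i) (enum_rank j)) (b i ** x ** b j) -
  \sum_i \sum_j scaleA (c i j) (b i ** x ** b j).
  rewrite -sumrB; apply: eq_bigr => k _; rewrite -sumrB; apply: eq_bigr => l _.
  by apply/ffunP=> r; rewrite !ffunE in_algB mulrBl.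
rewrite -cE // subr_eq0 -ev2 c'E //; apply/eqP.
by apply: eq_bigr => k _; apply: eq_bigr => l _; rewrite !enum_valK.
Qed.

Lemma linear_sum (phi : crossT L -> crossT L) (I : finType) (v : I -> F) (a : I -> crossT L) :
  (forall v w a a', V v -> V w -> inA V a -> inA V a' ->
     phi (scaleA v a + scaleA w a') = scaleA v (phi a) + scaleA w (phi a')) ->
  (forall i, v i \in vring V) -> (forall i, inA V (a i)) ->
  phi (\sum_i scaleA (v i) (a i)) = \sum_i scaleA (v i) (phi (a i)).
Proof.
move=> phiL Vv Aa; have V0 : V 0 by apply/vringP/rpred0.
have V1 : V 1 by apply/vringP/rpred1.
have s0 (z : crossT L) : scaleA 0 z = 0 by apply/ffunP=> r; rewrite !ffunE scale0r mul0r.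
have s1 (z : crossT L) : scaleA 1 z = z by apply/ffunP=> r; rewrite !ffunE scale1r mul1r.
have A0 : inA V (0 : crossT L) by apply/inAP => r; rewrite ffunE rpred0.
elim: (index_enum I) => [|i r IHr].
  by rewrite !big_nil; have := phiL 0 0 0 0 V0 V0 A0 A0; rewrite !s0 !addr0.
have Ar : inA V (\sum_(j <- r) scaleA (v j) (a j)).
  elim: r {IHr} => [|j r IHr]; first by rewrite big_nil.
  rewrite big_cons; apply/inAP=> s; rewrite !ffunE rpredD //; last by move: s; apply/inAP.
  by rewrite rpredM ?sring_in_alg //; move: s; apply/inAP.
rewrite !big_cons -{1}(s1 (\sum_(j <- r) _)) phiL ?s1 ?IHr //; exact/vringP.
Qed.

Hypothesis f_cocycle : normalized_cocycle V f.
Variables (n : nat) (x y : 'I_n -> L).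
Hypothesis xy : galois_system V x y.

Lemma crossT_expand (a : crossT L) :
  a = \sum_(k : G * 'I_n) scaleA (trF V (a k.1 * y k.2)) (xel (x k.2) k.1).
Proof.
apply/ffunP=> r; rewrite crossT_sumE {1}(galois_system_expand (a r) xy).
rewrite sum_pair /=.
rewrite (bigD1 r) //= [X in _ + X]big1 ?addr0 => [|s sr].
  by apply: eq_bigr => i _; rewrite scaleAE xelE eqxx.
by rewrite big1 // => i _; rewrite scaleAE xelE eq_sym (negPf sr) mulr0.
Qed.

(** The coefficient at [r] is [a r] times the sum of the [x j * r (t^-1 (y j))], which is 1 for
    [r = t] and 0 otherwise. *)
Lemma sandwich_proj (a : crossT L) (t : G) :
  \sum_j xel (x j) 1%g ** a ** xel ((t^-1)%g (y j)) 1%g = xel (a t) t.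
Proof.
apply/ffunP=> r; rewrite crossT_sumE xelE.
transitivity (a r * \sum_j x j * (t^-1 * r)%g (y j)).
  rewrite mulr_sumr; apply: eq_bigr => j _.
  rewrite mul_xelr mul_xel !invg1 mul1g mulg1 gal1f galMf.
  by rewrite (cocycle1l f_cocycle) (cocycle1r f_cocycle); ring.
case: xy => _ _ ->; rewrite -(inj_eq (mulgI t)) mulKVg mulg1.
by case: eqP => [->|_]; rewrite ?mulr1 ?mulr0.
Qed.

Hypothesis f_unit : forall s : G, unitS V (f s s^-1%g).
Hypothesis x_free :
  forall c : 'I_n -> F, \sum_i (c i)%:A * x i = 0 -> forall i, c i = 0.

(** Three operations composed: project [a] to [a_t x_t]; bring it to [a_t x_1] by a normalized
    [x_{t^-1}] on the right; multiply by [y i] and sum over [s] the conjugations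
    [u -> f(s, s^-1)^-1 x_s u x_{s^-1}], which send [u] in [S] to [s u]. *)
Lemma sandwich_trace (a : crossT L) (t : G) (i : 'I_n) :
  \sum_(k : G * 'I_n)
    xel (f k.1 k.1^-1%g)^-1 k.1 ** (xel (y i) 1%g ** xel (x k.2) 1%g) ** a **
     (xel ((t^-1)%g (y k.2)) 1%g ** xel ((t^-1)%g (f t t^-1%g)^-1) t^-1%g ** xel 1 k.1^-1%g)
  = scaleA (trF V (a t * y i)) (xel 1 1%g).
Proof.
have f0 s u : f s u != 0 by apply: (cocycle_neq0 f_cocycle).
rewrite scaleA_xel mulr1 trFE xel_sum.
rewrite sum_pair /=.
apply: eq_bigr => s _.
transitivity (xel (f s s^-1%g)^-1 s ** (xel (y i) 1%g ** ((\sum_j xel (x j) 1%g ** a **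
   xel ((t^-1)%g (y j)) 1%g) ** xel ((t^-1)%g (f t t^-1%g)^-1) t^-1%g)) ** xel 1 s^-1%g).
  rewrite mulA_suml !mulA_sumr mulA_suml; apply: eq_bigr => j _.
  by rewrite !(mulAA f_cocycle).
rewrite sandwich_proj !mul_xel_xel mulVg gal1f galKV rmorph1 !mul1g mulVg.
rewrite (cocycle1l f_cocycle) (cocycle1r f_cocycle); congr (xel _ _); rewrite !mulr1.
rewrite divfK // [y i * _]mulrC mulrAC mulVf ?mul1r //.
Qed.

Lemma azumaya_of_galois_system : azumaya V f.
Proof.
have [Sx Sy _] := xy.
have f0 s u : f s u != 0 by apply: (cocycle_neq0 f_cocycle).
pose b (k : G * 'I_n) := xel (x k.2) k.1.
have bA k : inA V (b k) by apply: inA_xel.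
have b_free (c : G * 'I_n -> F) : \sum_k scaleA (c k) (b k) = 0 -> forall k, c k = 0.
  move=> c0 [s i]; move: i; apply: x_free.
  have /ffunP/(_ s) := c0; rewrite crossT_sumE ffunE => {2}<-.
  rewrite sum_pair /=.
  rewrite [RHS](bigD1 s) //= [X in _ + X]big1 ?addr0 => [|t ts].
    by apply: eq_bigr => i _; rewrite scaleAE xelE eqxx.
  by rewrite big1 // => i _; rewrite scaleAE xelE eq_sym (negPf ts) mulr0.
apply: (azumaya_finType (b := b)) => //.
- move=> a /inAP Sa; exists (fun k => trF V (a k.1 * y k.2)); split; last exact: crossT_expand.
  by move=> k; apply/vringP/trF_sring; rewrite rpredM.
- move=> v Vv /(_ (xel 1 1%g)); move/(_ (inA_xel _ (rpred1 _))) => /ffunP/(_ 1%g).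
  by rewrite scaleAE xelE eqxx ffunE mulr1 => /eqP; rewrite in_alg_eq0 => /eqP.
- move=> phi phiA phiL.
  pose J := ((G * 'I_n) * (G * 'I_n))%type.
  (* Since [a] is the sum of the [tr (a_s y_i) b (s, i)], linearity makes [phi a] the sum of the
     [phi (b (s, i))] times the trace sandwich. The factor [phi (b (s, i))] is absorbed on the
     left. *)
  pose p (k : J) := phi (b k.1) ** (xel (f k.2.1 k.2.1^-1%g)^-1 k.2.1 **
    (xel (y k.1.2) 1%g ** xel (x k.2.2) 1%g)).
  pose t (k : J) := k.1.1.
  pose q (k : J) := xel ((t k)^-1%g (y k.2.2)) 1%g **
    xel ((t k)^-1%g (f (t k) (t k)^-1%g)^-1) (t k)^-1%g ** xel 1 k.2.1^-1%g.
  have Sf s : (f s s^-1%g)^-1 \in S by case: (f_unit s) => _ _ /sringP.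
  have pA k : inA V (p k).
    by do !apply: (inA_mul f_cocycle); try apply: inA_xel; rewrite ?Sf //; apply: phiA.
  have qA k : inA V (q k).
    by do !apply: (inA_mul f_cocycle); apply: inA_xel; rewrite ?sring_gal ?rpred1.
  have phiE a : inA V a -> phi a = \sum_(k : J) p k ** a ** q k.
    move=> /inAP Sa; rewrite {1}[a]crossT_expand.
    rewrite (linear_sum (a := b)) //; last by move=> k; rewrite trF_sring ?rpredM.
    rewrite [RHS]sum_pair /=.
    apply: eq_bigr => [[s i] _].
    transitivity (phi (b (s, i)) ** scaleA (trF V (a s * y i)) (xel 1 1%g)).
      rewrite mulA_scaler; congr scaleA; apply/ffunP=> r.
      by rewrite mul_xelr invg1 mul1g rmorph1 (cocycle1r f_cocycle) !mulr1.
    rewrite -sandwich_trace mulA_sumr; apply: eq_bigr => l _.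
    by rewrite /p /q /t /= !(mulAA f_cocycle).
  pose co (a : crossT L) (k : G * 'I_n) := trF V (a k.1 * y k.2).
  have Vco a k : inA V a -> co a k \in vring V.
    by move=> /inAP Sa; rewrite trF_sring ?rpredM.
  exists (fun k l => \sum_(m : J) co (p m) k * co (q m) l); split.
    by move=> k l; apply/vringP; rewrite rpred_sum // => m _; rewrite rpredM ?Vco.
  move=> a /phiE->; under [RHS]eq_bigr => k _ do under eq_bigr => l _ do rewrite scaleA_suml.
  under [RHS]eq_bigr => k _ do rewrite exchange_big.
  rewrite [RHS]exchange_big /=; apply: eq_bigr => m _.
  rewrite [in LHS](crossT_expand (p m)) mulA_suml mulA_suml; apply: eq_bigr => k _.
  rewrite [in LHS](crossT_expand (q m)) mulA_sumr; apply: eq_bigr => l _.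
  by rewrite !mulA_scalel mulA_scaler scaleA_scale.
move=> c c0 [s i] [r j].
have key (w : G) : \sum_k \sum_l (c (s, k) (r, l))%:A * (x k * w (x l)) = 0 :> L.
  (* With this [t] and the coefficient at [r * w], the term in the conjugate [s z] involves only
     left factors of index [s] and right factors of index [r], the latter twisted by [t * s = w]. *)
  pose t := (w * s^-1)%g.
  pose K u := f u t * f (t * u)%g (r * w * (t * u)^-1)%g *
    \sum_k \sum_l (c k l)%:A * (b k u * (t * u)%g (b l (r * w * (t * u)^-1)%g)).
  have : K s = 0.
    apply: (dedekind_sring (V := V)) => z Sz.
    have /ffunP/(_ (r * w)%g) := c0 _ (inA_xel t Sz).
    rewrite crossT_sumE [X in _ = X]ffunE => E; rewrite -[RHS]E.
    under [RHS]eq_bigr => k _ do rewrite crossT_sumE.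
    under [RHS]eq_bigr => k _ do under eq_bigr => l _ do rewrite scaleAE sandwich_coef mulr_sumr.
    rewrite /K; under [LHS]eq_bigr => u _ do rewrite mulr_sumr mulr_suml.
    rewrite [LHS]exchange_big /=; apply: eq_bigr => k _.
    under [LHS]eq_bigr => u _ do rewrite mulr_sumr mulr_suml.
    rewrite [LHS]exchange_big /=; apply: eq_bigr => l _.
    by apply: eq_bigr => u _; ring.
  move/eqP; rewrite /K mulf_eq0 mulf_eq0 (negPf (f0 _ _)) (negPf (f0 _ _)) /=.
  rewrite /t mulgKV mulgK => /eqP; rewrite sum_pair /=.
  rewrite (bigD1 s) //= [X in _ + X]big1 ?addr0 => [E|u us]; last first.
    rewrite big1 // => k _; rewrite big1 // => l _.
    by rewrite xelE eq_sym (negPf us) mul0r mulr0.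
  rewrite -[RHS]E; apply: eq_bigr => k _.
  rewrite sum_pair /=.
  rewrite [RHS](bigD1 r) //= [X in _ + X]big1 ?addr0 => [|u ur]; last first.
    by rewrite big1 // => l _; rewrite [X in w X]xelE eq_sym (negPf ur) rmorph0 !mulr0.
  by apply: eq_bigr => l _; rewrite !xelE !eqxx.
move: i; apply: x_free.
(* Multiplying by [w (y j)] and summing over [w] produces the traces of [x l * y j]. By duality only
   [l = j] remains, and freeness of the [x k] finishes. *)
have : \sum_(w : G) w (y j) * \sum_k \sum_l (c (s, k) (r, l))%:A * (x k * w (x l)) = 0.
  by rewrite big1 // => w _; rewrite key mulr0.
move=> {2}<-; under [RHS]eq_bigr => w _ do rewrite mulr_sumr.
rewrite [RHS]exchange_big /=; apply: eq_bigr => k _.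
under [RHS]eq_bigr => w _ do rewrite mulr_sumr.
rewrite [RHS]exchange_big /= (bigD1 j) //=.
have E l : \sum_(w : G) w (y j) * ((c (s, k) (r, l))%:A * (x k * w (x l))) =
   (c (s, k) (r, l))%:A * x k * (j == l)%:R.
  rewrite (_ : (j == l)%:R = (trF V (x l * y j))%:A); last first.
    by rewrite (galois_system_dual xy) // scaler_nat.
  rewrite trFE mulr_sumr; apply: eq_bigr => w _.
  by rewrite rmorphM /=; ring.
rewrite E eqxx mulr1 big1 ?addr0 // => l lj.
by rewrite E eq_sym (negPf lj) mulr0.
Qed.

End AzumayaOfGalois.

(** * Residue bases, the number of maximal ideals, ramification index one *)

Section ResidueBases.
Variables (F : fieldType) (L : splittingFieldType F) (V : galval L).
Local Notation G := (galT L).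
Local Notation S := (sring V).
Implicit Type M : maxspec V.

Lemma locSP M x : reflect (locS V (fun y => y \in M) x) (x \in loc M).
Proof. exact: asboolP. Qed.
Lemma locMP M x : reflect (locM V (fun y => y \in M) x) (x \in locm M).
Proof. exact: asboolP. Qed.

(** [P] stands for an ideal of [S]: one maximal ideal, the intersection of several, or zero as in
    [vspan]. *)
Definition residue_free (I : finType) (P : L -> Prop) (t : I -> L) :=
  forall v : I -> F, (forall i, v i \in vring V) ->
    P (\sum_i (v i)%:A * t i) -> forall i, v i \in vmax V.
Definition residue_span (I : finType) (P : L -> Prop) (t : I -> L) :=
  forall x, x \in S -> exists v : I -> F, (forall i, v i \in vring V) /\
    P (x - \sum_i (v i)%:A * t i).
Definition vspan (I : finType) (t : I -> L) :=
  residue_span (fun x => x = 0) t.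

Lemma residue_free_free (I : finType) (P : L -> Prop) (t : I -> L) :
  P 0 -> residue_free P t ->
  forall c : I -> F, \sum_i (c i)%:A * t i = 0 -> forall i, c i = 0.
Proof.
move=> P0 free c c0 i; apply/eqP; apply: contraT => /(vring_min_val V)[k ck Vk].
have := vmaxN1 V; rewrite -(divff ck); case/negP.
apply: (free (fun i => c i / c k)) => //.
rewrite (_ : \sum_i _ = (c k)^-1%:A * \sum_i (c i)%:A * t i); first by rewrite c0 mulr0.
by rewrite mulr_sumr; apply: eq_bigr => j _; rewrite in_algM [RHS]mulrA [_^-1%:A * _]mulrC.
Qed.

Lemma free_card_span (I : finType) (t : I -> L) :
  (forall c : I -> F, \sum_i (c i)%:A * t i = 0 -> forall i, c i = 0) ->
  #|I| = \dim (fullv : {vspace L}) ->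
  forall x, exists c : I -> F, x = \sum_i (c i)%:A * t i.
Proof.
move=> t_free dimL x.
pose X := [tuple t (enum_val i) | i < #|I|].
have ev (g : I -> L) : \sum_(i < #|I|) g (enum_val i) = \sum_i g i.
  by rewrite -(big_enum_val (A := I) g).
have XE (i : 'I_#|I|) : X`_i = t (enum_val i) by rewrite -tnth_nth tnth_mktuple.
have bX : basis_of fullv X.
  rewrite basisEfree subvf size_tuple -dimL leqnn !andbT; apply/freeP => k k0 i.
  have := t_free (k \o enum_rank) _ (enum_val i); rewrite /= enum_valK; apply.
  rewrite -ev -[RHS]k0; apply: eq_bigr => j _.
  by rewrite XE /= enum_valK mulr_algl.
exists (fun i => coord X (enum_rank i) x).
rewrite {1}(coord_basis bX (memvf x)) -ev; apply: eq_bigr => i _.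
by rewrite XE enum_valK mulr_algl.
Qed.

(** By dimension [x] is a combination over [F]. If the coefficient [c k] of least value were outside
    [V], its inverse would be in the maximal ideal, so [x / c k] would lie in every [M j] although
    its [k]-th coefficient is 1. *)
Lemma residue_free_vspan (I J : finType) (M : J -> maxspec V) (j0 : J) (t : I -> L) :
  residue_free (fun x => forall j, x \in M j) t ->
  #|I| = \dim (fullv : {vspace L}) -> vspan t.
Proof.
move=> free dimL x Sx.
have tf := residue_free_free (P := fun y => forall j, y \in M j) (fun j => rpred0 (M j)) free.
have [c xE] := free_card_span tf dimL x.
exists c; split=> [i|]; last by rewrite {1}xE subrr.
have [ci0 | /(vring_min_val V)[k ck Vk]] := eqVneq (c i) 0; first by rewrite ci0 rpred0.
case: (boolP (c k \in vring V)) => [Vck|nVck].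
  by rewrite -(divfK ck (c i)) rpredM.
have mk := vmax_inv nVck; have := vmaxN1 V; rewrite -(divff ck); case/negP.
apply: (free (fun i => c i / c k)) => // j.
rewrite (_ : \sum_i _ = (c k)^-1%:A * x); first by rewrite mxMr ?mx_vmax.
by rewrite xE mulr_sumr; apply: eq_bigr => l _; rewrite in_algM [RHS]mulrA [_^-1%:A * _]mulrC.
Qed.

Lemma res_degreeP M n : res_degree V (fun x => x \in M) n <->
  exists t : 'I_n -> L, [/\ forall i, t i \in S,
    residue_free (fun x => x \in M) t & residue_span (fun x => x \in M) t].
Proof.
split=> [[t [tl free span]]|[t [St free span]]]; last first.
  exists t; split=> [i|v Vv /locMP Mv i|x /locSP/loc_residue[s Ss Mxs]].
  - exact/locSP/sring_loc.
  - apply/vmaxP/free => [j|]; first exact/vringP.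
    rewrite -locm_mx // rpred_sum // => j _.
    by rewrite rpredM ?sring_in_alg //; apply/vringP.
  have [v [Vv Mv]] := span s Ss; exists v; split=> [i|]; first exact/vringP.
  by apply/locMP; rewrite -(subrK s x) -addrA rpredD //; apply: mx_locm.
have St i : t i \in loc M by apply/locSP.
have /choice[u uP] i : exists u, u \in S /\ t i - u \in locm M.
  by have [s] := loc_residue (St i); exists s.
have Su i : u i \in S by case: (uP i).
have tu (v : 'I_n -> F) : (forall i, v i \in vring V) ->
    \sum_i (v i)%:A * t i - \sum_i (v i)%:A * u i \in locm M.
  move=> Vv; rewrite -sumrB rpred_sum // => i _; rewrite -mulrBr.
  by case: (uP i) => _; apply: locmMl; rewrite sring_loc ?sring_in_alg.
exists u; split=> // [v Vv Mv i|x Sx].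
  apply/vmaxP; apply: free => [j|]; first exact/vringP.
  by apply/locMP; rewrite -(rpredBr _ (tu v Vv)) ?subKr ?mx_locm //.
have [|v [Vv /locMP Mv]] := span x; first exact/locSP/sring_loc.
have {}Vv i : v i \in vring V by exact/vringP.
exists v; split=> //; rewrite -locm_mx; last first.
  by rewrite rpredB ?rpred_sum // => i _; rewrite rpredM ?sring_in_alg.
by rewrite -[x](subrK (\sum_i (v i)%:A * t i)) -addrA rpredD ?tu.
Qed.

(** Multiply the basis for [M j] by an element [e j] that is 1 modulo [M j] and 0 modulo the others;
    modulo [M j] only the block of [j] survives. *)
Lemma crt_residue_basis (I J : finType) (M : J -> maxspec V) (t : J -> I -> L) :
  (forall i j, i != j -> ~ (M i =i M j)) ->
  (forall j, [/\ forall i, t j i \in S,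
    residue_free (fun x => x \in M j) (t j) & residue_span (fun x => x \in M j) (t j)]) ->
  exists z : J * I -> L, [/\ forall k, z k \in S,
    residue_free (fun x => forall j, x \in M j) z &
    residue_span (fun x => forall j, x \in M j) z].
Proof.
move=> dis tP.
have /choice[e eP] j : exists e, e \in S /\ (e - 1 \in M j /\ forall i, i != j -> e \in M i).
  by have [i ij|e Se He] := @mx_crt _ _ V _ M j; [exact: dis | exists e].
have Se j : e j \in S by case: (eP j).
have St j i : t j i \in S by case: (tP j).
pose z (k : J * I) := e k.1 * t k.1 k.2.
have Sz k : z k \in S by rewrite rpredM.
have zE (v : J * I -> F) j : (forall k, v k \in vring V) ->
    \sum_k (v k)%:A * z k - \sum_i (v (j, i))%:A * t j i \in M j.
  move=> Vv; rewrite sum_pair (bigD1 j) //= addrAC rpredD //.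
    rewrite -sumrB rpred_sum // => i _.
    rewrite /z /= -mulrBr -[X in _ * (_ - X)]mul1r -mulrBl mxMl ?sring_in_alg // mxMr //.
    by case: (eP j) => _ [].
  rewrite rpred_sum // => k kj; rewrite rpred_sum // => i _.
  rewrite mxMl ?sring_in_alg // mxMr //.
  by case: (eP k) => _ [_]; apply; rewrite eq_sym.
exists z; split=> // [v Vv Mv [j i]|x Sx].
  case: (tP j) => _ free _; apply: (free (fun i => v (j, i))) => //.
  rewrite -[X in X \in _](subKr (\sum_k (v k)%:A * z k)); apply: rpredB; first exact: Mv.
  exact: zE.
have /choice[v vP] j : exists v : I -> F, (forall i, v i \in vring V) /\
    x - \sum_i (v i)%:A * t j i \in M j.
  by case: (tP j) => _ _; apply.
exists (fun k => v k.1 k.2); split=> [k|j]; first by case: (vP k.1).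
have Vv (k : J * I) : v k.1 k.2 \in vring V by case: (vP k.1).
have [_ Mx] := vP j.
rewrite -[x](subrK (\sum_i (v j i)%:A * t j i)) -addrA rpredD //.
by rewrite -opprB rpredN; apply: (zE (fun k => v k.1 k.2) j Vv).
Qed.

Lemma num_max_idealsP r : num_max_ideals L V r <-> exists Ms : 'I_r -> maxspec V,
  (forall i j, i != j -> ~ (Ms i =i Ms j)) /\ forall M, exists i, M =i Ms i.
Proof.
split=> [[N [Nmax Ndis Nall]]|[Ms [dis all]]].
  exists (fun i => maxspec_of (Nmax i)); split=> [i j ij E|M].
    have [x] := Ndis i j ij; apply; have := E x; rewrite !maxspec_ofE => Ex.
    by split=> /asboolP Nx; apply/asboolP; [rewrite -Ex | rewrite Ex].
  have [i iE] := Nall _ (mxP M); exists i => x; rewrite maxspec_ofE.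
  by apply/idP/asboolP => /iE.
exists (fun i x => x \in Ms i); split=> [i|i j ij|N HN]; first exact: mxP.
  apply: contrapT => no; apply: (dis i j ij) => x; apply/idP/idP => Mx.
    by apply: contrapT => nMx; apply: no; exists x => -[/(_ Mx)].
  by apply: contrapT => nMx; apply: no; exists x => -[_ /(_ Mx)].
have [i iE] := all (maxspec_of HN); exists i => x; rewrite -iE maxspec_ofE.
by split=> [Nx|/asboolP//]; apply/asboolP.
Qed.

Lemma num_max_ideals_le r r' : num_max_ideals L V r -> num_max_ideals L V r' -> (r <= r')%N.
Proof.
move=> /num_max_idealsP[Ms [dis _]] /num_max_idealsP[Ms' [_ all']].
have /choice[g gE] i : exists j, Ms i =i Ms' j by exact: all'.
rewrite -[r]card_ord -[r']card_ord; apply: (leq_card g) => i j gij.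
apply/eqP; apply: contraT => /dis[] x; by rewrite gE gij -gE.
Qed.

Lemma num_max_ideals_uniq r r' : num_max_ideals L V r -> num_max_ideals L V r' -> r = r'.
Proof. by move=> Hr Hr'; apply/eqP; rewrite eqn_leq !num_max_ideals_le. Qed.

(** The value of [x] at [M] belongs to the value group of [V]. *)
Definition value_in_base M (x : L) :=
  exists (c : F) (u : L), [/\ c != 0, u \in loc M, u \notin locm M & x = c%:A * u].

Lemma unit_locSE M u : unit_locS V (fun x => x \in M) u <-> u \in loc M /\ u \notin locm M.
Proof.
split=> [/unit_locSP[? ? ?]|[lu nu]]; first by rewrite unit_nlocm.
by have [? ?] := loc_unit lu nu; apply/unit_locSP.
Qed.

Lemma loc_unitM M x y : x \in loc M -> x \notin locm M -> y \notin locm M ->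
  x * y \notin locm M.
Proof.
move=> lx nx; apply: contra => mxy; have [x0 lx'] := loc_unit lx nx.
by rewrite -[y](mulKf x0) locmMl.
Qed.

Lemma loc_unitV M x : x \in loc M -> x \notin locm M ->
  x^-1 \in loc M /\ x^-1 \notin locm M.
Proof.
by move=> lx nx; have [x0 lx'] := loc_unit lx nx; rewrite lx' unit_nlocm ?invr_eq0 ?invrK.
Qed.

Lemma ram_index1P M : ram_index V (fun x => x \in M) 1 <->
  forall x, x != 0 -> value_in_base M x.
Proof.
split=> [[rho [rho0 _ gen]] x x0|vb]; last first.
  exists (fun=> 1); split=> [i|i j|x /vb[c [u [c0 lu nu ->]]]]; first exact: oner_neq0.
    by rewrite !ord1 eqxx.
  by exists ord0, c, u; split=> //; [apply/unit_locSE | rewrite mulr1].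
have [i [c [u [c0 /unit_locSE[lu nu] ->]]]] := gen x x0.
(* The only representative [rho ord0] is arbitrary; comparing it with 1 shows that its own value
   comes from [F]. *)
have [j [d [w [d0 /unit_locSE[lw nw]]]]] := gen 1 (oner_neq0 _).
rewrite (ord1 i) (ord1 j) => E1; have [w0 lw'] := loc_unit lw nw.
have [_ nw'] := loc_unitV lw nw.
exists (c / d), (u / w); split; rewrite ?mulf_neq0 ?invr_eq0 ?rpredM ?loc_unitM //.
have dA : d%:A != 0 :> L by rewrite in_alg_eq0.
have dw : d%:A * w != 0 by rewrite mulf_neq0.
have -> : rho ord0 = (d%:A * w)^-1 by apply: (mulfI dw); rewrite -E1 divff.
by rewrite in_algM in_algV; field; rewrite w0 dA.
Qed.

Lemma ram_index_eq1 M e : ram_index V (fun x => x \in M) 1 ->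
  ram_index V (fun x => x \in M) e -> e = 1%N.
Proof.
move=> /ram_index1P vb [rho [rho0 dis gen]].
case: e => [|[|e]] // in rho rho0 dis gen *; first by case: (gen 1 (oner_neq0 _)) => -[].
exfalso; apply: (dis ord0 ord_max) => //.
have [c [u [c0 lu nu ->]]] := vb _ (rho0 ord0).
have [d [w [d0 lw nw ->]]] := vb _ (rho0 ord_max).
have [w0 lw'] := loc_unit lw nw; have [_ nw'] := loc_unitV lw nw.
exists (c / d), (u / w); split; first by rewrite mulf_neq0 ?invr_eq0.
  by apply/unit_locSE; rewrite rpredM ?loc_unitM.
have dA : d%:A != 0 :> L by rewrite in_alg_eq0.
by rewrite in_algM in_algV; field; rewrite w0 dA.
Qed.

End ResidueBases.

(** * From unramified and defectless to a Galois system *)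

Section UnramifiedDefectless.
Variables (F : fieldType) (L : splittingFieldType F) (V : galval L).
Local Notation G := (galT L).
Local Notation S := (sring V).
Local Notation iota := (map_poly (in_alg L)).
Implicit Type M : maxspec V.

Lemma sring_taylor (p : {poly L}) x y : p \is a polyOver S -> x \in S -> y \in S ->
  exists2 w, w \in S & p.[y] = p.[x] + (y - x) * (p^`().[x] + (y - x) * w).
Proof.
move=> + Sx Sy; elim/poly_ind: p => [|p c IHp] Spc.
  by exists 0; rewrite ?rpred0 // deriv0 !horner0; ring.
have /IHp[w Sw pE] : p \is a polyOver S.
  apply/polyOverP=> i; move/polyOverP/(_ i.+1): Spc.
  by rewrite coefD coefMX coefC /= addr0.
exists (p^`().[x] + y * w); last by rewrite derivD derivM derivX derivC !hornerE pE; ring.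
rewrite rpredD ?rpredM ?rpred_horner ?polyOver_deriv //.
apply/polyOverP=> i; move/polyOverP/(_ i.+1): Spc.
by rewrite coefD coefMX coefC /= addr0.
Qed.

Lemma iota_polyOver (p : {poly F}) : p \is a polyOver (vring V) -> iota p \is a polyOver S.
Proof. by move=> /polyOverP Vp; apply/polyOverP => i; rewrite coef_map /= sring_in_alg. Qed.

Lemma iota_vmax M (p : {poly F}) x : x \in S -> p \is a polyOver (vmax V) ->
  (iota p).[x] \in M.
Proof.
move=> Sx /polyOverP mp; rewrite horner_coef rpred_sum // => i _.
by rewrite mxMr ?rpredX // coef_map mx_vmax.
Qed.

Lemma gal_horner (s : G) (p : {poly F}) x : s (iota p).[x] = (iota p).[s x].
Proof.
rewrite -horner_map -map_poly_comp; congr (_.[_]).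
by apply: eq_map_poly => c /=; rewrite gal_in_alg.
Qed.

Lemma locm_in_alg M (c : F) : c%:A \in locm M -> c \in vmax V.
Proof.
move=> mc; case: (boolP (c \in vring V)) => [Vc|/vmax_inv mc'].
  by rewrite -(mx_vmax M) -locm_mx // sring_in_alg.
have := locmN1 M; case: (eqVneq c 0) => [-> _|c0]; first exact: rpred0.
case/negP; rewrite -(scale1r 1) -(mulVf c0) in_algM locmMl // locm_sub //.
by rewrite locm_mx ?mx_vmax // sring_in_alg vmax_sub.
Qed.

Lemma eq1_gal (s : G) : {in S, forall x, s x = x} -> s = 1%g.
Proof.
move=> sS; apply/eqP/gal_eqP => x _; rewrite gal1f.
have [d _ [d0 Sdx]] := sring_fraction V x.
apply: (mulfI (_ : d%:A != 0)); first by rewrite in_alg_eq0.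
by rewrite -{1}(gal_in_alg s) -rmorphM /= sS.
Qed.

(* If [s] acts trivially modulo [M], some [x0] in the finite generating family
   minimizes the valuation of [s x - x], say [s x0 - x0 = c u0].  A separable
   equation [p] of [x0] modulo [M] has [p(x0) = c1 u1] with [c1] in the maximal
   ideal of [V]; then [p(s x0) - p(x0)] is divisible by [c1 c] but is also
   [c] times a unit. *)
Lemma inertia_trivial M (I : finType) (z : I -> L) (s : G) :
  ram_index V (fun x => x \in M) 1 -> res_separable V (fun x => x \in M) ->
  (forall i, z i \in S) -> vspan V z ->
  (forall x, x \in S -> s x - x \in M) -> s = 1%g.
Proof.
move=> /ram_index1P vb sep Sz zspan sM.
have vb' x : exists cu : F * L, [/\ cu.2 \in loc M, cu.2 \notin locm M & x = cu.1%:A * cu.2].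
  have [->|/vb[c [u [_ lu nu ->]]]] := eqVneq x 0; last by exists (c, u).
  by exists (0, 1); rewrite rpred1 locmN1 scale0r mul0r.
have /choice[cu cuP] i := vb' (s (z i) - z i).
have dz i : s (z i) - z i = (cu i).1%:A * (cu i).2 by case: (cuP i).
apply: contrapT => s1.
have [i0 ci0] : exists i, (cu i).1 != 0.
  apply: contrapT => no; apply: s1; apply: eq1_gal => x /zspan[v [Vv /eqP]].
  rewrite subr_eq0 => /eqP->; rewrite rmorph_sum; apply: eq_bigr => i _.
  rewrite rmorphM /= gal_in_alg; congr (_ * _); apply/eqP; rewrite -subr_eq0 dz.
  have [->|ci] := eqVneq (cu i).1 0; first by rewrite scale0r mul0r.
  by case: no; exists i.
have [k ck Vk] := @vring_min_val _ _ V _ (fun i => (cu i).1) _ ci0.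
pose c := (cu k).1; pose u0 := (cu k).2; pose x0 := z k.
have cA : c%:A != 0 :> L by rewrite in_alg_eq0.
have sl x : x \in S -> (s x - x) / c%:A \in loc M.
  move=> /zspan[v [Vv /eqP]]; rewrite subr_eq0 => /eqP->.
  rewrite rmorph_sum -sumrB mulr_suml rpred_sum // => i _.
  rewrite rmorphM /= gal_in_alg -mulrBr dz.
  rewrite (_ : _ / _ = (v i)%:A * ((cu i).1 / c)%:A * (cu i).2); last first.
    by rewrite in_algM in_algV; field.
  apply: rpredM; last by case: (cuP i).
  by rewrite sring_loc // rpredM ?sring_in_alg // Vk.
have Sx0 : x0 \in S by apply: Sz.
have [p [/(_ _)/vringP Vp [/locMP px0 [a [b [Va Vb mab]]]]]] := sep _ (elimT (locSP M x0) (sring_loc M Sx0)).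
have Pp : p \is a polyOver (vring V) by apply/polyOverP.
have Pa : a \is a polyOver (vring V) by apply/polyOverP => i; apply/vringP.
have Pb : b \is a polyOver (vring V) by apply/polyOverP => i; apply/vringP.
have Sev (q : {poly F}) x : q \is a polyOver (vring V) -> x \in S -> (iota q).[x] \in S.
  by move=> Pq Sx; rewrite rpred_horner ?iota_polyOver.
have Pp' : p^`() \is a polyOver (vring V) by rewrite polyOver_deriv.
have np' : (iota p^`()).[x0] \notin M.
  apply/negP=> Mp'; case/negP: (mxN1 M).
  pose A := (iota a).[x0] * (iota p).[x0] + (iota b).[x0] * (iota p^`()).[x0].
  have mE : A - 1 \in M.
    have := @iota_vmax M (a * p + b * p^`() - 1) x0 Sx0.
    rewrite rmorphB rmorphD !rmorphM rmorph1 /= hornerD hornerN hornerC hornerD !hornerM; apply.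
    by apply/polyOverP => i; apply/vmaxP.
  rewrite -[1](subKr A) rpredB // /A rpredD // mxMl ?Sev //.
  by rewrite -locm_mx ?Sev.
have [[c1 u1] /= [lu1 nu1 pE]] := vb' (iota p).[x0].
have [u10 lu1V] := loc_unit lu1 nu1.
have mc1 : c1 \in vmax V.
  by apply: (@locm_in_alg M); rewrite -(mulfK u10 c1%:A) -pE mulrC locmMl.
(* The bound on [s x - x] extends from [S] to [u1 = g / h] by the quotient rule; [s h] stays outside
   [M] because [s] is trivial modulo [M]. *)
have lsu1 : (s u1 - u1) / c%:A \in loc M.
  have /locP[g [h [Sg Sh Mh ->]]] := lu1.
  have nsh : s h \notin M.
    by apply: contra Mh => Msh; rewrite -(subKr (s h) h) rpredB ?sM.
  have h0 := nmx_neq0 Mh; have sh0 := nmx_neq0 nsh.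
  rewrite (_ : _ / _ = (h * ((s g - g) / c%:A) - g * ((s h - h) / c%:A)) / (h * s h)).
    rewrite rpredM //; first by apply: rpredB; apply: rpredM; rewrite ?sl // sring_loc.
    by apply/locP; exists 1, (h * s h); split; rewrite ?rpred1 ?rpredM ?mxMn ?mul1r ?sring_gal.
  by rewrite rmorphM fmorphV /=; field; rewrite h0 sh0 cA.
have ldp : ((iota p).[s x0] - (iota p).[x0]) / c%:A \in locm M.
  rewrite -gal_horner pE rmorphM /= gal_in_alg -mulrBr -mulrA mulrC.
  by rewrite locmMl // mx_locm // mx_vmax.
have Ssx0 : s x0 \in S by rewrite sring_gal.
have [w Sw tE] := sring_taylor (iota_polyOver Pp) Sx0 Ssx0.
have Mz : (iota p^`()).[x0] + (s x0 - x0) * w \notin locm M.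
  rewrite locm_mx; last by rewrite rpredD ?Sev // rpredM ?rpredB.
  by apply: contra np' => Me; rewrite -(addrK ((s x0 - x0) * w) (iota _).[_]) rpredB // mxMr // sM.
have [lu0 nu0 d0] := cuP k.
case/negP: (loc_unitM lu0 nu0 Mz); move: ldp; rewrite tE addrC addKr deriv_map.
rewrite [X in X * (_ + _) / _](d0 : s x0 - x0 = c%:A * u0).
have E Q : c%:A * u0 * Q / c%:A = u0 * Q by field.
by rewrite E.
Qed.

(** The ring homomorphism [x (x) y -> x * s y] on the tensor square of [S], applied to a tensor
    given by its terms. Multiplicativity lets tensors vanishing at different [s] be combined. *)
Definition tensor_eval (I : finType) (x y : I -> L) (s : G) := \sum_i x i * s (y i).

Lemma galois_system_of_inertia :
  (forall M (s : G), (forall x, x \in S -> s x - x \in M) -> s = 1%g) ->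
  exists (I : finType) (x y : I -> L), galois_system V x y.
Proof.
move=> inert.
have sep1 (s : G) : s != 1%g -> exists (I : finType) (x y : I -> L),
    [/\ forall i, x i \in S, forall i, y i \in S,
        tensor_eval x y 1%g = 1 & tensor_eval x y s = 0].
  (* [P] is the ideal of values at 1 of the tensors that vanish at [s]. Were it proper, it would lie
     in some [M], modulo which [s] would act trivially. *)
  move=> s1; pose P t := exists (I : finType) (x y : I -> L),
    [/\ forall i, x i \in S, forall i, y i \in S,
        tensor_eval x y 1%g = t & tensor_eval x y s = 0].
  apply: contrapT => P1; have [|M PM] := @ideal_maxspec _ _ V P _ P1.
    split=> [t [I [x [y [Sx Sy <- _]]]]||t t'|a t].
    - by apply/sringP/rpred_sum => i _; rewrite rpredM // gal1f.
    - by exists void, (fun=> 0), (fun=> 0); split=> [[]|[]||]; rewrite /tensor_eval big1 // => -[].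
    - move=> [I [x [y [Sx Sy xy1 xys]]]] [J [x' [y' [Sx' Sy' xy1' xys']]]].
      exists (I + J)%type, (fun k => match k with inl i => x i | inr j => x' j end),
        (fun k => match k with inl i => y i | inr j => y' j end).
      split=> [[]|[]||] //; rewrite /tensor_eval big_sumType /=; first by rewrite -xy1 -xy1'.
      by transitivity (tensor_eval x y s + tensor_eval x' y' s); rewrite // xys xys' addr0.
    move=> /sringP Sa [I [x [y [Sx Sy xy1 xys]]]].
    exists I, (fun i => a * x i), y; split=> // [i||]; first by rewrite rpredM.
      by rewrite -xy1 mulr_sumr; apply: eq_bigr => i _; rewrite mulrA.
    transitivity (a * tensor_eval x y s); last by rewrite xys mulr0.
    by rewrite mulr_sumr; apply: eq_bigr => i _; rewrite mulrA.
  case/eqP: s1; apply: (inert M) => b Sb; rewrite -opprB rpredN; apply: PM.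
  (* The tensor [1 (x) b - s b (x) 1] has value [b - s b] at 1 and 0 at [s]. *)
  exists bool, (fun i => if i then 1 else - s b), (fun i => if i then b else 1).
  split=> [[]|[]||]; rewrite ?rpred1 ?rpredN ?sring_gal //.
    by rewrite /tensor_eval big_bool /= !gal1f mul1r mulr1.
  by rewrite /tensor_eval big_bool /= rmorph1 mul1r mulr1 subrr.
have sepr (r : seq G) : all (fun s => s != 1%g) r -> exists (I : finType) (x y : I -> L),
    [/\ forall i, x i \in S, forall i, y i \in S,
        tensor_eval x y 1%g = 1 & {in r, forall s, tensor_eval x y s = 0}].
  elim: r => [_|s r IHr /= /andP[s1 /IHr[J [x' [y' [Sx' Sy' xy1' xyr]]]]]].
    exists unit, (fun=> 1), (fun=> 1); split=> //= [_|_|]; rewrite ?rpred1 //.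
    by rewrite /tensor_eval big_const card_unit /= addr0 gal1f mulr1.
  have [I [x [y [Sx Sy xy1 xys]]]] := sep1 s s1.
  pose X (k : I * J) := x k.1 * x' k.2; pose Y (k : I * J) := y k.1 * y' k.2.
  have evM (t : G) : tensor_eval X Y t = tensor_eval x y t * tensor_eval x' y' t.
    rewrite /tensor_eval sum_pair mulr_suml; apply: eq_bigr => i _.
    by rewrite mulr_sumr; apply: eq_bigr => j _; rewrite /X /Y rmorphM /=; ring.
  exists (I * J)%type, X, Y; split=> [k|k||t]; rewrite ?rpredM //.
    by rewrite evM xy1 xy1' mulr1.
  by rewrite inE evM => /orP[/eqP->|/xyr->]; rewrite ?xys ?mul0r ?mulr0.
have [|I [x [y [Sx Sy xy1 xys]]]] := sepr [seq s <- enum {: G} | s != 1%g].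
  exact: filter_all.
exists I, x, y; split=> // s; case: (eqVneq s 1%g) => [->//|s1].
by apply: xys; rewrite mem_filter s1 mem_enum.
Qed.

Lemma galois_system_of_unramified : unramified L V -> defectless L V ->
  exists (I : finType) (x y : I -> L), galois_system V x y.
Proof.
move=> unr def.
have [M0 _] : exists M : maxspec V, forall x, x = 0 -> x \in M.
  apply: ideal_maxspec; last exact/eqP/oner_neq0.
  split=> [x ->|//|x y -> ->|s x _ ->]; rewrite ?addr0 ?mulr0 //.
  exact/sringP/rpred0.
have defM M : exists f r, [/\ res_degree V (fun x => x \in M) f, num_max_ideals L V r &
    \dim (fullv : {vspace L}) = (f * r)%N].
  have [e [f [r [re rf nr dimL]]]] := def _ (mxP M).
  have [r1 _] := unr _ (mxP M); exists f, r; split=> //.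
  by rewrite dimL (ram_index_eq1 r1 re) mul1n.
have [f [r [_ nr dimL]]] := defM M0.
have /num_max_idealsP[Ms [dis all]] := nr.
have [j0 _] := all M0.
have r0 : (0 < r)%N by case: (r) j0 => [[]|].
have /choice[t tP] j : exists t : 'I_f -> L, [/\ forall i, t i \in S,
    residue_free V (fun x => x \in Ms j) t & residue_span V (fun x => x \in Ms j) t].
  have [f' [r' [rf' nr' dimL']]] := defM (Ms j).
  (* The residue degree is the same at every maximal ideal, since [f' * r] and [f * r] both equal
     the degree of the extension. *)
  apply/res_degreeP; suff -> : f = f' by [].
  move: dimL'; rewrite (num_max_ideals_uniq nr' nr) dimL => /eqP.
  by rewrite eqn_pmul2r // => /eqP.
have [z [Sz zfree _]] := crt_residue_basis dis tP.
have zspan : vspan V z.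
  by apply: (residue_free_vspan j0 zfree); rewrite card_prod !card_ord dimL mulnC.
apply: galois_system_of_inertia => M s sM.
have [r1 sep] := unr _ (mxP M).
exact: (inertia_trivial r1 sep Sz zspan sM).
Qed.

End UnramifiedDefectless.

(** * Conjugacy of maximal ideals, and ramification index one *)

Section GaloisRamification.
Variables (F : fieldType) (L : splittingFieldType F) (V : galval L).
Local Notation G := (galT L).
Local Notation S := (sring V).
Implicit Type M : maxspec V.

(** Otherwise some [x] in [M'] is congruent to 1 modulo every [mxpre M s]. Its norm is then in [M']
    and not in [M], although both ideals meet [F] in the maximal ideal of [V]. *)
Lemma maxspec_conj M M' : exists s : G, M' =i mxpre M s.
Proof.
apply: contrapT => no.
have /choice[a aP] s : exists a, a \in M' /\ 1 - a \in mxpre M s.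
  have [|a Ma Mb] := @mx_comax _ _ _ M' (mxpre M s); last by exists a.
  by move=> E; apply: no; exists s.
pose x := 1 - \prod_(s : G) (1 - a s).
have Mx : x \in M'.
  rewrite /x -opprB rpredN; apply: prod_sub1 => s _.
  by rewrite addrC addKr rpredN; case: (aP s).
have Sx := mx_sub Mx.
have nsx (s : G) : s x \notin M.
  apply/negP=> Msx; case/negP: (mxN1 M).
  rewrite -(subrK (s x) 1) rpredD // -(rmorph1 s) -rmorphB /x subKr.
  rewrite (bigD1 s) //= rmorphM mxMr //; last by case: (aP s).
  by rewrite sring_gal rpred_prod // => t _; rewrite rpredB ?rpred1 // (mx_sub (proj1 (aP t))).
have [v Nv] := norm_exists V x.
have : v%:A \notin M by rewrite -Nv mx_prodn // => s _; rewrite sring_gal.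
rewrite mx_vmax -(mx_vmax M') -Nv (bigD1 1%g) //= gal1f mxMr // rpred_prod // => s _.
by rewrite sring_gal.
Qed.

(* Kaplansky: lowering the degree of an equation with a coefficient outside [M]. *)
Lemma loc_total_poly M n (q : {poly L}) x i : (size q <= n)%N ->
  q \is a polyOver S -> q.[x] = 0 -> q`_i \notin M -> (x \in loc M) || (x^-1 \in loc M).
Proof.
elim: n q i => [|n IHn] q i sq Sq qx qi.
  by move: qi; rewrite nth_default ?rpred0 // (leq_trans sq).
have Sqi j : q`_j \in S by move/polyOverP: Sq; apply.
have iq : (i < size q)%N by rewrite ltnNge; apply: contra qi => qi; rewrite nth_default ?rpred0.
have [m mE] : exists m, size q = m.+1 by exists (size q).-1; rewrite prednK // (leq_ltn_trans _ iq).
case: m mE => [|m] mE.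
  have qE := size1_polyC (eq_leq mE).
  by move: qx qi iq; rewrite qE hornerC => q0; rewrite coefC q0 if_same rpred0.
pose c := q`_m.+1; pose b := c * x.
have Sb : b \in S by rewrite /b /c -[m.+1]/(m.+2.-1) -mE -lead_coefE lead_mul_root // /root qx.
case: (boolP (c \in M)) => [Mc|nMc]; last first.
  have c0 := nmx_neq0 nMc; apply/orP; left; apply/locP; exists b, c; split=> //; first exact: Sqi.
  by rewrite /b mulrAC divff ?mul1r.
(* The two highest terms of [q] are merged by reading [c * x ^+ m.+1] as [b * x ^+ m], which is
   legitimate because [b] is in [S]. *)
pose q2 := \poly_(j < m.+1) q`_j + b *: 'X^m.
have q2E j : q2`_j = (if (j < m.+1)%N then q`_j else 0) + b * (j == m)%:R.
  by rewrite coefD coef_poly coefZ coefXn.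
have [[k q2k]|q2M] := pselect (exists k, q2`_k \notin M).
  apply: (IHn q2 k) => //.
  - rewrite mE ltnS in sq; apply: leq_trans sq; apply/leq_sizeP => j mj.
    by rewrite q2E ltnNge mj gtn_eqF ?mulr0 ?addr0.
  - apply/polyOverP => j; rewrite q2E rpredD //; first by case: ifP; rewrite ?rpred0.
    by case: eqP; rewrite ?mulr1 ?mulr0 ?rpred0.
  rewrite hornerD hornerZ hornerXn horner_poly /b -mulrA -exprS -[RHS]qx horner_coef mE.
  by rewrite [RHS]big_ord_recr.
have {}q2M j : q2`_j \in M by apply: contraT => nM; case: q2M; exists j.
(* If every coefficient of [q2] is in [M], the coefficient of [q] outside [M] can only be the one
   altered, so [b] is outside [M] and [x^-1 = c / b]. *)
have im : i = m.
  have := q2M i; rewrite q2E; case: eqP => // im; rewrite mulr0 addr0.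
  rewrite ifT ?(negPf qi) // ltn_neqAle -ltnS -mE iq andbT.
  by apply: contraNneq qi => ->.
have nMb : b \notin M.
  apply: contra qi => Mb; have := q2M m; rewrite q2E ltnSn eqxx mulr1 -im => Me.
  by rewrite -[X in X \in _](addrK b) rpredB.
have x0 : x != 0 by apply: contraNneq nMb => x0; rewrite /b x0 mulr0 rpred0.
apply/orP; right; apply/locP; exists c, b; split=> //; first exact: Sqi.
have c0 : c != 0 by apply: contraNneq nMb => c0; rewrite /b c0 mul0r rpred0.
by rewrite /b invfM mulrA divff // mul1r.
Qed.

Lemma loc_total M x : (x \in loc M) || (x^-1 \in loc M).
Proof.
have [q Vq [[i qi] qx]] := algebraic_vring V x.
apply: (@loc_total_poly M _ (map_poly (in_alg L) q) x i (leqnn _)).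
- exact: iota_polyOver.
- exact/rootP.
- by rewrite coef_map qi /= scale1r mxN1.
Qed.

Variables (I : finType) (x y : I -> L).
Hypothesis xy : galois_system V x y.

(** Take for [c] a trace of least value among the [trF V (z * y i)]: the expansion of [z] along the
    [x i] then has coefficients divisible by [c]. *)
Lemma galois_trace_content z : z != 0 -> exists (c : F) (w : L) (i : I),
  [/\ c != 0, w \in S, z = c%:A * w & trF V (w * y i) = 1].
Proof.
have [Sx Sy _] := xy; move=> z0; have zE := galois_system_expand z xy.
have [i ti] : exists i, trF V (z * y i) != 0.
  apply: contrapT => no; move: z0; rewrite zE big1 ?eqxx // => i _.
  have [->|ti] := eqVneq (trF V (z * y i)) 0; first by rewrite scale0r mul0r.
  by case: no; exists i.
have [k tk Vk] := @vring_min_val _ _ V _ (fun i => trF V (z * y i)) _ ti.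
set c := trF V (z * y k) in tk Vk; have cA : c%:A != 0 :> L by rewrite in_alg_eq0.
exists c, (z / c%:A), k; split=> //.
- rewrite {1}zE mulr_suml rpred_sum // => j _.
  by rewrite mulrAC -in_algV -in_algM rpredM // sring_in_alg.
- by rewrite mulrC divfK.
by rewrite -in_algV mulrAC mulrC trFZ mulVf.
Qed.

(** Write [z = c * w] with [trF V (w * y i) = 1]. As [w] also has least value among its conjugates,
    [w] in [M] would put every [s w], and with them the trace 1, in [M]. *)
Lemma value_in_base_min M z : z != 0 -> (forall s : G, s z / z \in loc M) ->
  value_in_base M z.
Proof.
have [Sx Sy _] := xy; move=> z0 zmin.
have [c [w [i [c0 Sw zE trw]]]] := galois_trace_content z0.
have cA : c%:A != 0 :> L by rewrite in_alg_eq0.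
have w0 : w != 0 by apply: contraNneq z0 => w0; rewrite zE w0 mulr0.
exists c, w; split; rewrite ?sring_loc ?locm_mx //; apply/negP => Mw.
case/negP: (mxN1 M); rewrite -(scale1r 1) -trw trFE rpred_sum // => s _.
rewrite rmorphM /= mxMr ?sring_gal // -locm_mx ?sring_gal //.
rewrite -(divfK w0 (s w)) locmMl ?mx_locm //.
have := zmin s; rewrite zE rmorphM /= gal_in_alg (_ : _ / _ = s w / w) //.
by field; rewrite w0 cA.
Qed.

(* [B] collects conjugates of [z] of lowest valuation, so the product over [B]
   has the least valuation among its conjugates. *)
Lemma prod_lowest_min M z (B : pred G) : z != 0 ->
  (forall s : G, ~~ B s -> s z / z \in loc M) -> (forall s : G, B s -> z / s z \in loc M) ->
  value_in_base M (\prod_(s | B s) s z).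
Proof.
move=> z0 hi lo; have sz0 (s : G) : s z != 0 by rewrite fmorph_eq0.
have P0 : \prod_(s | B s) s z != 0 by apply/prodf_neq0 => s _.
apply: value_in_base_min => // t.
have -> : t (\prod_(s | B s) s z) / \prod_(s | B s) s z =
    \prod_(s | B s) (t (s z) / z) * \prod_(s | B s) (z / s z).
  rewrite rmorph_prod -prodfV -!big_split /=; apply: eq_bigr => s _.
  by field; rewrite sz0 z0.
(* Numerator and denominator are now matched by the conjugate [s z]: each factor is 1, or [s z / z]
   with [s] outside [B], or [z / s z] with [s] in [B]. *)
rewrite (reindex_inj (mulIg t^-1)%g) /=.
under eq_bigr => s _ do rewrite galMf galKV.
rewrite big_mkcond [X in _ * X]big_mkcond -big_split rpred_prod // => s _ /=.
case: (boolP (B s)) => Bs; case: ifP => _; rewrite ?mulr1 ?mul1r ?rpred1 ?lo ?hi //.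
by rewrite (_ : _ * _ = 1) ?rpred1 //; field; rewrite sz0 z0.
Qed.

Lemma galois_system_ram_index M : ram_index V (fun x => x \in M) 1.
Proof.
apply/ram_index1P => z z0.
have sz0 (s : G) : s z != 0 by rewrite fmorph_eq0.
pose A := [pred s : G | s z / z \notin loc M].
have lo s : A s -> z / s z \in loc M.
  by move=> /= As; have := loc_total M (s z / z); rewrite (negPf As) invf_div.
have nA1 : ~~ A 1%g by rewrite /= gal1f divff // rpred1.
(* Both products have values in [F], and since 1 is not in [A] their quotient is exactly [z]. *)
have [s|a [u [a0 lu nu aE]]] := @prod_lowest_min M z A z0 _ lo; first by rewrite negbK.
have [s|s|b [w [b0 lw nw bE]]] := @prod_lowest_min M z (fun s => A s || (s == 1%g)) z0.
- by rewrite negb_or negbK => /andP[].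
- by case/orP=> [/lo//|/eqP->]; rewrite gal1f divff // rpred1.
have E : \prod_(s | A s || (s == 1%g)) s z = z * \prod_(s | A s) s z.
  rewrite (bigD1 1%g) ?eqxx ?orbT //= gal1f; congr (_ * _); apply: eq_bigl => s.
  case: (eqVneq s 1%g) => [->|_]; last by rewrite orbF andbT.
  by rewrite andbF; apply/esym/negbTE.
have [u0 lu'] := loc_unit lu nu; have [_ nu'] := loc_unitV lu nu.
have aA : a%:A != 0 :> L by rewrite in_alg_eq0.
exists (b / a), (w / u); split; rewrite ?mulf_neq0 ?invr_eq0 ?rpredM ?loc_unitM //.
move: bE; rewrite E aE in_algM in_algV => /(canRL (mulfK (mulf_neq0 aA u0))) ->.
by field; rewrite u0 aA.
Qed.

End GaloisRamification.

(** * Lifted polynomial arithmetic modulo a maximal ideal *)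

Lemma monic_division (E : fieldType) (R : subringClosed E) (g p : {poly E}) :
  g \is monic -> g \is a polyOver R -> p \is a polyOver R ->
  exists q r : {poly E}, [/\ q \is a polyOver R, r \is a polyOver R,
    p = q * g + r & (size r < size g)%N].
Proof.
move=> g_monic Rg; have g0 := monic_neq0 g_monic.
elim: {p}(size p) {-2}p (leqnn (size p)) => [|n IHn] p sp Rp.
  exists 0, 0; rewrite rpred0 mul0r addr0 size_poly0 size_poly_gt0; split=> //.
  by apply/eqP; rewrite -size_poly_leq0.
case: (ltnP (size p) (size g)) => [pg|gp].
  by exists 0, p; rewrite rpred0 mul0r add0r.
pose d := (size p - size g)%N; pose m := lead_coef p *: 'X^d.
have Rm : m \is a polyOver R.
  by rewrite polyOverZ ?rpredX ?polyOverX // lead_coefE; move/polyOverP: Rp; apply.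
have [||q [r [Rq Rr pE rg]]] := IHn (p - m * g); last first.
- by exists (q + m), r; split; rewrite ?rpredD // mulrDl addrAC -pE subrK.
- by rewrite rpredB ?rpredM.
have g1 : (0 < size g)%N by rewrite size_poly_gt0.
have [p1 sp'] : (0 < size p)%N /\ ((size p).-1 <= n)%N by lia.
apply: leq_trans sp'; apply/leq_sizeP => j pj.
rewrite coefB -scalerAl coefZ coefXnM.
have dj : (d <= j)%N by rewrite /d; lia.
rewrite ltnNge dj /=.
case: (ltnP (size p).-1 j) => [pj'|jp].
  have -> : p`_j = 0 by apply: nth_default; rewrite -(prednK p1).
  have gj : (size g <= j - d)%N by rewrite /d; lia.
  have -> : g`_(j - d) = 0 by apply: nth_default.
  by rewrite mulr0 subrr.
have -> : j = (size p).-1 by lia.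
have -> : ((size p).-1 - d = (size g).-1)%N by rewrite /d; lia.
by rewrite -lead_coefE -lead_coefE (monicP g_monic) mulr1 subrr.
Qed.

(** A substitute for the monic generator of an ideal of polynomials over the field [R / N], stated
    for lifts. It will serve for a minimal polynomial over the residue field of [V], for a greatest
    common divisor there, and for polynomials over [S / M] vanishing on an orbit. *)
Lemma monic_minimal (E : fieldType) (R : subringClosed E) (N : zmodClosed E)
    (K : {poly E} -> Prop) :
  {subset N <= R} ->
  (forall a c, a \in R -> c \in N -> a * c \in N) ->
  (forall c, c \in R -> c \notin N -> exists2 c', c' \in R & c' * c - 1 \in N) ->
  (forall p q, K p -> K q -> K (p - q)) -> (forall c p, c \in R -> K p -> K (c *: p)) ->
  (forall p, p \is a polyOver N -> K p) ->
  (exists g, [/\ g \is monic, g \is a polyOver R & K g]) ->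
  exists h, [/\ h \is monic, h \is a polyOver R, K h &
    forall r, r \is a polyOver R -> K r -> (size r < size h)%N -> r \is a polyOver N].
Proof.
move=> NR NM inv KB KZ KN [g0 [g0_monic Rg0 Kg0]].
pose P n := `[< exists g, [/\ g \is monic, g \is a polyOver R, K g & size g = n] >].
have exP : exists n, P n by exists (size g0); apply/asboolP; exists g0.
have [n /asboolP[h [h_monic Rh Kh sh]] hmin] := ex_minnP exP.
exists h; split=> // r Rr Kr rh.
have Rri i : r`_i \in R by move/polyOverP: Rr; apply.
apply: contrapT => nNr.
have [i0 i0P] : exists i, r`_i \notin N.
  by apply: contrapT => no; apply: nNr; apply/polyOverP => i; apply: contraT => ri; case: no; exists i.
have bound i : r`_i \notin N -> (i <= size r)%N.
  by move=> ri; rewrite leqNgt; apply: contra ri => /ltnW ri; rewrite nth_default ?rpred0.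
(* [k] is the degree of [r] modulo [N]. Dropping the higher terms and inverting [r_k] modulo [N]
   gives the monic [r1], congruent to [c *: r] and smaller than [h]. *)
have [k rk kmax] := ex_maxnP (ex_intro (fun i => r`_i \notin N) i0 i0P) bound.
have [c Rc Nc] := inv _ (Rri k) rk.
pose t := \poly_(i < k) (c * r`_i); pose r1 := 'X^k + t.
have sr1 : (size t < size ('X^k : {poly E}))%N.
  by rewrite size_polyXn ltnS size_poly.
have kr : (k < size r)%N by rewrite ltnNge; apply: contra rk => rk; rewrite nth_default ?rpred0.
suff : P (size r1).
  by move/hmin; rewrite -sh leqNgt /r1 size_polyDl // size_polyXn (leq_ltn_trans kr).
apply/asboolP; exists r1; split=> //.
- by rewrite monicE /r1 lead_coefDl // lead_coefXn.
- by rewrite rpredD ?rpredX ?polyOverX //; apply/polyOver_poly => i _; rewrite rpredM.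
rewrite -[r1](subKr (c *: r)); apply: KB; first exact: KZ.
apply: KN; apply/polyOverP => i; rewrite coefB coefZ coefD coefXn coef_poly.
case: (ltngtP i k) => [ik|ki|->]; rewrite ?add0r ?subrr ?rpred0 ?addr0 ?subr0 //.
by rewrite NM //; apply: contraT => /kmax; rewrite leqNgt ki.
Qed.

(** * The decomposition group and residue separability *)

Section GaloisSeparability.
Variables (F : fieldType) (L : splittingFieldType F) (V : galval L).
Local Notation G := (galT L).
Local Notation S := (sring V).
Local Notation iota := (map_poly (in_alg L)).
Variable M : maxspec V.

Definition decomp : pred G := fun s => `[< M =i mxpre M s >].

Lemma decompP (s : G) : reflect (forall x, (s x \in M) = (x \in M)) (decomp s).
Proof.
apply: (iffP (asboolP _)) => sM x; first by rewrite -mxpreE -sM.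
by rewrite mxpreE sM.
Qed.

Lemma decomp1 : decomp 1%g. Proof. by apply/decompP => x; rewrite gal1f. Qed.

Lemma decompM (s t : G) : decomp s -> decomp t -> decomp (s * t)%g.
Proof. by move=> /decompP Ds /decompP Dt; apply/decompP=> x; rewrite galMf Dt Ds. Qed.

Lemma decompV (s : G) : decomp s -> decomp s^-1%g.
Proof. by move=> /decompP Ds; apply/decompP=> x; rewrite -Ds galKV. Qed.

Lemma decomp_isolate : exists e, [/\ e \in S, e - 1 \in M &
  forall s : G, ~~ decomp s -> s e \in M].
Proof.
have /choice[a aP] (s : G) : exists a, ~~ decomp s -> a \in mxpre M s /\ 1 - a \in M.
  case: (boolP (decomp s)) => [_|/asboolP nD]; first by exists 0.
  have [|a Ma Mb] := @mx_comax _ _ _ (mxpre M s) M; last by exists a.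
  by move=> E; apply: nD => x; rewrite E.
have Sa s : ~~ decomp s -> a s \in S by move=> /aP[/mx_sub].
exists (\prod_(s | ~~ decomp s) a s); split; first exact: rpred_prod.
  by apply: prod_sub1 => s /aP[_]; rewrite -opprB rpredN.
move=> s nDs; rewrite (bigD1 s) //= rmorphM mxMr //; last by case: (aP s nDs).
by rewrite sring_gal rpred_prod // => t /andP[/Sa].
Qed.

Lemma horner_congr (q : {poly L}) u v : q \is a polyOver S -> u \in loc M -> v \in loc M ->
  u - v \in locm M -> q.[u] - q.[v] \in locm M.
Proof.
move=> /polyOverP Sq lu lv muv; rewrite !horner_coef -sumrB rpred_sum // => i _.
rewrite -mulrBr locmMl ?sring_loc // subrXX mulrC locmMl // rpred_sum // => j _.
by rewrite rpredM ?rpredX.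
Qed.

Lemma mx_horner (q : {poly L}) u : q \is a polyOver M -> u \in S -> q.[u] \in M.
Proof.
move=> /polyOverP Mq Su; rewrite horner_coef rpred_sum // => i _.
by rewrite mxMr ?rpredX.
Qed.

(** A simple root need not make [p] itself coprime to its derivative, so [p] is replaced by the
    minimal polynomial [g] of [x] over the residue field. It divides [p] there, hence [x] is also a
    simple root of [g]. *)
Lemma residue_root_separable x : x \in S ->
  (exists p : {poly F}, [/\ p \is a polyOver (vring V), (iota p).[x] \in M &
     (iota p^`()).[x] \notin M]) ->
  exists g a b : {poly F}, [/\ g \is a polyOver (vring V), (iota g).[x] \in M,
    a \is a polyOver (vring V), b \is a polyOver (vring V) &
    a * g + b * g^`() - 1 \is a polyOver (vmax V)].
Proof.
move=> Sx [p [Vp Mp np']].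
have Sev (q : {poly F}) : q \is a polyOver (vring V) -> (iota q).[x] \in S.
  by move=> Vq; rewrite rpred_horner ?iota_polyOver.
have Vinv c : c \in vring V -> c \notin vmax V -> exists2 c', c' \in vring V & c' * c - 1 \in vmax V.
  by move=> Vc mc; have [c0 Vc'] := vunit_inv Vc mc; exists c^-1; rewrite // mulVf ?subrr ?rpred0.
have mM (q r : {poly F}) : q \is a polyOver (vring V) -> r \is a polyOver (vmax V) ->
    q * r \is a polyOver (vmax V).
  move=> /polyOverP Vq /polyOverP mr; apply/polyOverP => i; rewrite coefM rpred_sum // => j _.
  by rewrite vmaxMl.
have mV (q : {poly F}) : q \is a polyOver (vmax V) -> q \is a polyOver (vring V).
  by move=> /polyOverP mq; apply/polyOverP => i; apply: vmax_sub.
have mZ (q : {poly F}) c : c \in vring V -> q \is a polyOver (vmax V) ->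
    c *: q \is a polyOver (vmax V).
  by move=> Vc mq; rewrite -mul_polyC mM // polyOverC.
have m' (q : {poly F}) : q \is a polyOver (vmax V) -> q^`() \is a polyOver (vmax V).
  by move=> /polyOverP mq; apply/polyOverP => i; rewrite coef_deriv rpredMn.
have monicN (q : {poly F}) : q \is monic -> q \isn't a polyOver (vmax V).
  move=> /monicP q1; apply/negP => /polyOverP/(_ (size q).-1).
  by rewrite -lead_coefE q1 (negPf (vmaxN1 V)).
have [||||g [g_monic Vg Mg gmin]] := @monic_minimal F (vring V) (vmax V)
  (fun r => (iota r).[x] \in M) (@vmax_sub _ _ V) (@vmaxMl _ _ V) Vinv.
- by move=> q r Mq Mr; rewrite rmorphB hornerD hornerN rpredB.
- by move=> c q Vc Mq; rewrite map_polyZ hornerZ mxMl //= sring_in_alg.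
- by move=> q; apply: iota_vmax.
- have /sringP[q [q_monic Vq /rootP qx]] := Sx; exists q; split=> //.
    by apply/polyOverP => i; apply/vringP.
  by rewrite qx rpred0.
have ng' : (iota g^`()).[x] \notin M.
  have [k [r [Vk Vr pE rg]]] := monic_division g_monic Vg Vp.
  have mr : r \is a polyOver (vmax V).
    apply: gmin => //; have -> : r = p - k * g by rewrite pE addrC addKr.
    by rewrite rmorphB rmorphM hornerD hornerN hornerM rpredB // mxMl ?Sev.
  apply: contra np' => Mg'; rewrite pE derivD derivM !(rmorphD, rmorphM) /= !hornerE.
  have Vk' : k^`() \is a polyOver (vring V) by rewrite polyOver_deriv.
  by rewrite !rpredD ?iota_vmax ?m' // mxMl ?Sev.
have Vg' : g^`() \is a polyOver (vring V) by rewrite polyOver_deriv.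
pose Z (r : {poly F}) := exists a b : {poly F}, [/\ a \is a polyOver (vring V),
  b \is a polyOver (vring V) & r - (a * g + b * g^`()) \is a polyOver (vmax V)].
have ZM q r : q \is a polyOver (vring V) -> Z r -> Z (q * r).
  move=> Vq [a [b [Va Vb mr]]]; exists (q * a), (q * b); split; rewrite ?rpredM //.
  rewrite (_ : _ - _ = q * (r - (a * g + b * g^`()))) ?mM //.
  by rewrite mulrBr mulrDr !mulrA.
have ZB q r : Z q -> Z r -> Z (q - r).
  move=> [a [b [Va Vb mq]]] [a' [b' [Va' Vb' mr]]].
  exists (a - a'), (b - b'); split; [exact: rpredB | exact: rpredB |].
  have -> : q - r - ((a - a') * g + (b - b') * g^`()) =
    (q - (a * g + b * g^`())) - (r - (a' * g + b' * g^`())) by ring.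
  exact: rpredB.
have Zg : Z g by exists 1, 0; rewrite rpred1 rpred0 mul1r mul0r addr0 subrr rpred0.
have Zg' : Z g^`() by exists 0, 1; rewrite rpred1 rpred0 mul1r mul0r add0r subrr rpred0.
have [|||h [h_monic Vh Zh hmin]] := @monic_minimal F (vring V) (vmax V)
  Z (@vmax_sub _ _ V) (@vmaxMl _ _ V) Vinv ZB.
- by move=> c q Vc Zq; rewrite -mul_polyC; apply: ZM; rewrite // polyOverC.
- by move=> q mq; exists 0, 0; rewrite rpred0 !mul0r addr0 subr0.
- by exists g.
have [k [r [Vk Vr gE rh]]] := monic_division h_monic Vh Vg.
have mr : r \is a polyOver (vmax V).
  by apply: hmin => //; have -> : r = g - k * h; [rewrite gE addrC addKr | apply: ZB => //; apply: ZM].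
have Mkh : (iota k).[x] * (iota h).[x] \in M.
  have -> : (iota k).[x] * (iota h).[x] = (iota g).[x] - (iota r).[x].
    by rewrite gE rmorphD rmorphM hornerD hornerM addrK.
  by apply: rpredB => //; apply: iota_vmax.
have [Mk|Mh] := orP (mx_prime (Sev _ Vk) (Sev _ Vh) Mkh); last first.
  case/negP: ng'; have [k' [r' [Vk' Vr' g'E r'h]]] := monic_division h_monic Vh Vg'.
  have mr' : r' \is a polyOver (vmax V).
    apply: hmin => //; have -> : r' = g^`() - k' * h by rewrite g'E addrC addKr.
    by apply: ZB => //; apply: ZM.
  by rewrite g'E rmorphD rmorphM hornerD hornerM rpredD ?iota_vmax // mxMl ?Sev.
have sgk : (size g <= size k)%N.
  rewrite leqNgt; apply/negP => /(gmin _ Vk Mk) mk; case/negP: (monicN _ g_monic).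
  by rewrite gE rpredD // mulrC mM.
have k0 : k != 0.
  by apply: contraTneq sgk => ->; rewrite size_poly0 leqn0 size_poly_eq0 monic_neq0.
have k1 : (0 < size k)%N by rewrite size_poly_gt0.
have h1 : (0 < size h)%N by rewrite size_poly_gt0 monic_neq0.
have skh : size (k * h) = (size k + (size h).-1)%N.
  by rewrite size_Mmonic // -[in LHS](prednK h1) addnS.
have sg : size g = (size k + (size h).-1)%N.
  rewrite gE size_polyDl skh // (leq_trans rh) // -[X in (X <= _)%N](prednK h1).
  by rewrite -addn1 addnC leq_add2r.
have hE : h = 1.
  move: sgk; rewrite sg -[X in (_ <= X)%N]addn0 leq_add2l leqn0 => /eqP sh.
  have sh1 : size h = 1%N by rewrite -(prednK h1) sh.
  have := h_monic; rewrite [h]size1_polyC ?sh1 // monicE lead_coefC => /eqP->.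
  by rewrite polyC1.
move: Zh; rewrite hE => -[a [b [Va Vb m1]]].
by exists g, a, b; split=> //; rewrite -opprB rpredN.
Qed.

Variables (I : finType) (x y : I -> L).
Hypothesis xy : galois_system V x y.

(** The trace of [e * y i * u] is congruent to [u * T]: [e] suppresses the conjugates outside the
    decomposition group, and [u] is fixed by the others. Some [T] is outside [M] because the sums
    [T] weighted by the [x i] add up to 1; dividing the trace for [u = z] by that for [u = 1] gives
    the element of [V]. *)
Lemma decomp_fixed z : z \in S -> (forall s : G, decomp s -> s z - z \in M) ->
  exists2 v, v \in vring V & z - v%:A \in M.
Proof.
have [Sx Sy xyE] := xy; move=> Sz fz; have [e [Se Me eD]] := decomp_isolate.
have [i nT] : exists i, \sum_(s : G | decomp s) s (y i) \notin M.
  apply: contrapT => no; case/negP: (mxN1 M).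
  have -> : 1 = \sum_i x i * \sum_(s : G | decomp s) s (y i).
    under eq_bigr => i _ do rewrite mulr_sumr.
    rewrite exchange_big /= (bigD1 1%g) ?decomp1 //= xyE eqxx big1 ?addr0 // => s /andP[_ s1].
    by rewrite xyE (negPf s1).
  rewrite rpred_sum // => i _; rewrite mxMl //.
  by apply: contraT => ni; case: no; exists i.
set T := \sum_(s : G | _) _ in nT.
have trE u : u \in S -> (forall s : G, decomp s -> s u - u \in M) ->
    (trF V (e * y i * u))%:A - u * T \in M.
  move=> Su fu; rewrite trFE (bigID decomp) /= addrAC rpredD //; last first.
    by rewrite rpred_sum // => s /eD Mse; rewrite !rmorphM /= -mulrA mxMr ?rpredM ?sring_gal.
  rewrite mulr_sumr -sumrB rpred_sum // => s Ds; rewrite !rmorphM /=.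
  rewrite (_ : _ - _ = (s e - 1) * (s (y i) * s u) + (s u - u) * s (y i)); last by ring.
  rewrite rpredD // mxMr ?rpredM ?sring_gal ?fu //.
  by rewrite -(rmorph1 s) -rmorphB; move/decompP: Ds => ->.
have V0 u : u \in S -> trF V (e * y i * u) \in vring V by move=> Su; rewrite trF_sring ?rpredM.
have f1 (s : G) : decomp s -> s 1 - 1 \in M by rewrite rmorph1 subrr rpred0.
set A := trF V (e * y i * z); set B := trF V (e * y i * 1).
have MA := trE z Sz fz; have MB := trE 1 (rpred1 _) f1; rewrite mul1r in MB.
have nB : B \notin vmax V.
  by rewrite -(mx_vmax M); apply: contra nT => Mb; rewrite -(subKr B%:A T) rpredB.
have [B0 VB] := vunit_inv (V0 _ (rpred1 _)) nB.
have VAB : A / B \in vring V by rewrite rpredM ?V0.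
exists (A / B) => //.
have SAB : z - (A / B)%:A \in S by rewrite rpredB ?sring_in_alg.
have SB : B%:A \in S by rewrite sring_in_alg V0 ?rpred1.
suff /(mx_prime SAB SB) : (z - (A / B)%:A) * B%:A \in M by rewrite mx_vmax (negPf nB) orbF.
rewrite mulrBl -in_algM divfK //.
rewrite (_ : _ - _ = z * (B%:A - T) - (A%:A - z * T)); last by ring.
by rewrite rpredB // mxMl.
Qed.

(** Let [h] be minimal over [S / M] among the polynomials vanishing on the orbit of [z] under the
    decomposition group. That group preserves the vanishing condition, so it fixes [h] modulo [M]
    and the coefficients of [h] can be moved to [V]. A multiple root would allow a smaller
    polynomial. *)
Lemma galois_residue_root z : z \in S ->
  exists p : {poly F}, [/\ p \is a polyOver (vring V), (iota p).[z] \in M &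
    (iota p^`()).[z] \notin M].
Proof.
move=> Sz; pose K (r : {poly L}) := forall s : G, decomp s -> r.[s z] \in M.
have Ssz (s : G) : s z \in S by rewrite sring_gal.
have [|||||h [h_monic Sh Kh hmin]] := @monic_minimal L S M K (@mx_sub _ _ V M) (@mxMl _ _ V M).
- move=> c Sc nc; have [c' Sc' Mc] := mx_inv Sc nc; exists c'; rewrite // mulrC //.
- by move=> p q Kp Kq s Ds; rewrite hornerD hornerN rpredB ?Kp ?Kq.
- by move=> c p Sc Kp s Ds; rewrite hornerZ mxMl ?Kp.
- by move=> p Mp s _; apply: mx_horner.
- have /sringP[q [q_monic Vq /rootP qz]] := Sz; exists (iota q); split.
  + exact: monic_map.
  + by apply: iota_polyOver; apply/polyOverP => i; apply/vringP.
  + by move=> s _; rewrite -gal_horner qz rmorph0 rpred0.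
have Shi i : h`_i \in S by move/polyOverP: Sh; apply.
have /choice[v vP] i : exists v, v \in vring V /\ h`_i - v%:A \in M.
  suff [v Vv Mv] : exists2 v, v \in vring V & h`_i - v%:A \in M by exists v.
  apply: decomp_fixed => // s Ds.
  (* The leading terms cancel, so the difference has smaller size than [h] and vanishes on the same
     orbit. *)
  suff : map_poly s h - h \is a polyOver M by move/polyOverP/(_ i); rewrite coefB coef_map.
  have Ssh : map_poly s h \is a polyOver S.
    by apply/polyOverP => j; rewrite coef_map /= sring_gal.
  apply: hmin; first exact: rpredB.
    move=> t Dt; rewrite hornerD hornerN rpredB ?Kh //.
    have -> : t z = s ((t * s^-1)%g z) by rewrite galMf galKV.
    rewrite horner_map /=.
    by move/decompP: (Ds) => ->; apply: Kh; rewrite decompM ?decompV.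
  have h1 : (0 < size h)%N by rewrite size_poly_gt0 monic_neq0.
  rewrite -(prednK h1) ltnS; apply/leq_sizeP => j hj; rewrite coefB coef_map /=.
  move: hj; rewrite leq_eqVlt => /orP[/eqP<-|].
    by rewrite -lead_coefE (monicP h_monic) rmorph1 subrr.
  by rewrite prednK // => hj; rewrite nth_default // rmorph0 subrr.
pose p := \poly_(i < size h) v i.
have Vp : p \is a polyOver (vring V) by apply/polyOver_poly => i _; case: (vP i).
have hp : h - iota p \is a polyOver M.
  apply/polyOverP => i; rewrite coefB coef_map coef_poly /=.
  case: ltnP => [_|hi]; first by case: (vP i).
  by rewrite nth_default // scale0r subrr rpred0.
have hp' : h^`() - iota p^`() \is a polyOver M.
  by rewrite -deriv_map -derivB; apply/polyOverP => i; rewrite coef_deriv rpredMn //; apply/polyOverP.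
have hz : h.[z] \in M by have := Kh 1%g decomp1; rewrite gal1f.
exists p; split=> //.
  rewrite -[X in X \in _](subKr h.[z]) rpredB // -hornerN -hornerD; exact: mx_horner.
have [k [r [Sk Sr hE rX]]] := @monic_division L S ('X - z%:P) h (monicXsubC _)
  (etrans (polyOverXsubC _ _) Sz) Sh.
have [c rE] : exists c, r = c%:P.
  by exists r`_0; apply: size1_polyC; move: rX; rewrite size_XsubC.
have cE : c = h.[z] by rewrite hE rE !hornerE subrr mulr0 add0r.
have h'E : h^`().[z] = k.[z].
  by rewrite hE rE derivD derivM derivXsubC derivC !hornerE subrr mulr0 add0r.
apply/negP => Mp'.
have Mk : k.[z] \in M.
  rewrite -h'E -[X in X \in _](subrK (iota p^`()).[z]) rpredD // -hornerN -hornerD.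
  exact: mx_horner.
(* At a conjugate distinct from [z] modulo [M], [k] vanishes because [h] does; at one congruent to
   [z], because [z] is a multiple root. *)
have Kk : K k.
  move=> s Ds; have := Kh s Ds; rewrite hE rE cE !hornerE => Me.
  have {Me}: k.[s z] * (s z - z) \in M by rewrite -[X in X \in _](addrK h.[z]) rpredB.
  have Sk' w : w \in S -> k.[w] \in S by move=> Sw; rewrite rpred_horner.
  have Sd : s z - z \in S by rewrite rpredB.
  case/(mx_prime (Sk' _ (Ssz s)) Sd)/orP => // Md.
  have Sdk : k.[s z] - k.[z] \in S by rewrite rpredB ?Sk'.
  rewrite -(subrK k.[z] k.[s z]) rpredD // -locm_mx //.
  by apply: horner_congr; rewrite ?sring_loc ?locm_mx.
have nh : h \isn't a polyOver M.
  apply/negP => /polyOverP/(_ (size h).-1).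
  by rewrite -lead_coefE (monicP h_monic) (negPf (mxN1 M)).
have Mr : r \is a polyOver M by rewrite rE polyOverC cE.
case/negP: nh; rewrite hE rpredD //.
have [->|k0] := eqVneq k 0; first by rewrite mul0r rpred0.
have k1 : (0 < size k)%N by rewrite size_poly_gt0.
have skX : size (k * ('X - z%:P)) = (size k).+1.
  by rewrite size_Mmonic ?monicXsubC // size_XsubC addnC.
have /polyOverP Mk' : k \is a polyOver M.
  apply: hmin => //; rewrite hE size_polyDl skX // (leq_trans rX) //.
  by rewrite size_XsubC.
have SX : 'X - z%:P \is a polyOver S by rewrite polyOverXsubC.
move/polyOverP in SX; apply/polyOverP => i; rewrite coefM rpred_sum // => j _.
by rewrite mxMr.
Qed.

Lemma galois_system_res_separable : res_separable V (fun z => z \in M).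
Proof.
move=> u /locSP lu; have [z Sz muz] := loc_residue lu.
have [g [a [b [Vg Mg Va Vb mab]]]] := residue_root_separable Sz (galois_residue_root Sz).
exists g; split; first by move=> i; apply/vringP; move/polyOverP: Vg; apply.
split; last first.
  exists a, b; split=> i.
  - by apply/vringP; move/polyOverP: Va; apply.
  - by apply/vringP; move/polyOverP: Vb; apply.
  - by apply/vmaxP; move/polyOverP: mab; apply.
apply/locMP; rewrite -[X in X \in _](subrK (iota g).[z]) rpredD //; last exact: mx_locm.
by apply: horner_congr => //; [exact: iota_polyOver | exact: sring_loc].
Qed.

End GaloisSeparability.

(** * Defectlessness by Nakayama's lemma *)

Section GaloisDefectless.
Variables (F : fieldType) (L : splittingFieldType F) (V : galval L).
Local Notation G := (galT L).
Local Notation S := (sring V).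
Implicit Type M : maxspec V.

(** All maximal ideals are conjugates of [M]; [g] selects one group element for each of them, and
    its image indexes them without repetition. *)
Lemma maxspec_orbit M : exists r (s : 'I_r -> G),
  (forall i j, i != j -> ~ (mxpre M (s i) =i mxpre M (s j))) /\
  forall M', exists i, M' =i mxpre M (s i).
Proof.
pose e (s t : G) := `[< mxpre M s =i mxpre M t >].
pose g s := odflt s [pick t | e s t].
have eg s : mxpre M s =i mxpre M (g s).
  by rewrite /g; case: pickP => [t /asboolP|//].
have gE s t : mxpre M s =i mxpre M t -> g s = g t.
  move=> st; have ee : e s =1 e t.
    by move=> u; apply/asboolP/asboolP => E z; rewrite -E st.
  rewrite /g (eq_pick ee); case: pickP => // /(_ t).
  by rewrite /e; case: asboolP => // -[].
pose A := [set g s | s : G].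
exists #|A|, enum_val; split=> [i j ij Eij|M'].
  have /imsetP[s _ si] := enum_valP i; have /imsetP[t _ tj] := enum_valP j.
  move: ij; rewrite -(inj_eq enum_val_inj) si tj; case/eqP; apply: gE => z.
  by rewrite eg -si Eij tj -eg.
have [s sE] := maxspec_conj M M'.
have Ag : g s \in A by apply: imset_f.
by exists (enum_rank_in Ag (g s)) => z; rewrite sE enum_rankK_in // eg.
Qed.

Lemma residue_pre M n (t : 'I_n -> L) (s : G) :
  [/\ forall i, t i \in S, residue_free V (fun x => x \in M) t &
      residue_span V (fun x => x \in M) t] ->
  let t' i := (s^-1)%g (t i) in
  [/\ forall i, t' i \in S, residue_free V (fun x => x \in mxpre M s) t' &
      residue_span V (fun x => x \in mxpre M s) t'].
Proof.
move=> [St free span] t'.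
have st' (v : 'I_n -> F) : s (\sum_i (v i)%:A * t' i) = \sum_i (v i)%:A * t i.
  rewrite rmorph_sum; apply: eq_bigr => i _.
  by rewrite rmorphM /= gal_in_alg galKV.
split=> [i|v Vv|z Sz]; first by rewrite sring_gal.
  by rewrite mxpreE st'; apply: free.
have [|v [Vv Mv]] := span (s z); first by rewrite sring_gal.
by exists v; split=> //; rewrite mxpreE rmorphB /= st'.
Qed.

Variables (I : finType) (x y : I -> L).
Hypothesis xy : galois_system V x y.

(** A spanning family of minimal length: a relation with a coefficient that is a unit of [V] would
    let one member be dropped. The trace expansion provides a finite family to start from. *)
Lemma galois_residue_basis M : exists n (t : 'I_n -> L),
  [/\ forall i, t i \in S, residue_free V (fun z => z \in M) t &
      residue_span V (fun z => z \in M) t].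
Proof.
pose P n := `[< exists t : 'I_n -> L, (forall i, t i \in S) /\
  residue_span V (fun z => z \in M) t >].
have exP : exists n, P n.
  have [n [x' [y' xy']]] := galois_system_ord xy; have [Sx' Sy' _] := xy'.
  exists n; apply/asboolP; exists x'; split=> // z Sz.
  exists (fun i => trF V (z * y' i)); split=> [i|]; first by rewrite trF_sring ?rpredM.
  by rewrite -(galois_system_expand z xy') subrr rpred0.
have [n /asboolP[t [St span]] nmin] := ex_minnP exP.
exists n, t; split=> // v Vv Mv k; apply: contraT => nk.
have [vk0 Vvk] := vunit_inv (Vv k) nk.
case: n => [|n] in t St span nmin v Vv Mv k nk vk0 Vvk *; first by case: k nk vk0 Vvk.
suff : P n by move/nmin; rewrite ltnn.
apply/asboolP; exists (fun i => t (lift k i)); split=> // z Sz.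
have [w [Vw Mw]] := span z Sz.
exists (fun i => w (lift k i) - w k * (v (lift k i) / v k)); split=> [i|].
  by rewrite rpredB ?rpredM.
have -> : z - \sum_i (w (lift k i) - w k * (v (lift k i) / v k))%:A * t (lift k i) =
    (z - \sum_i (w i)%:A * t i) + (w k / v k)%:A * \sum_i (v i)%:A * t i.
  rewrite [\sum_i (w i)%:A * t i](bigD1_ord k) // [\sum_i (v i)%:A * t i](bigD1_ord k) //=.
  have -> : \sum_i (w (lift k i) - w k * (v (lift k i) / v k))%:A * t (lift k i) =
      \sum_i (w (lift k i))%:A * t (lift k i) -
      (w k / v k)%:A * \sum_i (v (lift k i))%:A * t (lift k i).
    rewrite mulr_sumr -sumrB; apply: eq_bigr => i _.
    by rewrite in_algB !in_algM in_algV; ring.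
  have vA : (v k)%:A != 0 :> L by rewrite in_alg_eq0.
  by rewrite mulrDr mulrA -in_algM divfK //; ring.
by rewrite rpredD // mxMl // sring_in_alg rpredM.
Qed.

(* Nakayama's lemma, by removing the generators [x] one at a time. *)
Lemma galois_residue_vspan M (J : finType) (z : J -> L) :
  residue_span V (fun u => forall s : G, s u \in M) z -> vspan V z.
Proof.
have [Sx Sy _] := xy; move=> span.
pose P n := `[< exists w : 'I_n -> L, (forall i, w i \in S) /\
  forall u, u \in S -> exists (v : J -> F) (m : 'I_n -> F),
    [/\ forall j, v j \in vring V, forall i, m i \in vmax V &
        u = \sum_j (v j)%:A * z j + \sum_i (m i)%:A * w i] >].
have exP : exists n, P n.
  have [n [x' [y' xy']]] := galois_system_ord xy; have [Sx' Sy' _] := xy'.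
  exists n; apply/asboolP; exists x'; split=> // u Su.
  have [v [Vv Mv]] := span u Su; set d := u - _ in Mv.
  exists v, (fun i => trF V (d * y' i)); split=> // [i|]; last first.
    by rewrite -(galois_system_expand d xy') /d addrC subrK.
  (* All conjugates of [d] lie in [M], hence so does the trace, which is therefore in the maximal
     ideal of [V]. *)
  rewrite -(mx_vmax M) trFE rpred_sum // => s _.
  by rewrite rmorphM /= mxMr ?sring_gal //; apply: Mv.
have [n /asboolP[w [Sw gen]] nmin] := ex_minnP exP.
case: n => [|n] in w Sw gen nmin *.
  move=> u /gen[v [m [Vv _ ->]]]; exists v; split=> //.
  by rewrite big_ord0 addr0 subrr.
suff : P n by move/nmin; rewrite ltnn.
apply/asboolP; exists (fun i => w (lift ord0 i)); split=> // u Su.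
have [v0 [m0 [Vv0 mm0 w0E]]] := gen _ (Sw ord0).
have [v [m [Vv mm ->]]] := gen u Su.
have Vm0 : 1 - m0 ord0 \in vring V by rewrite rpredB ?rpred1 // vmax_sub.
have [|d0 Vd] := vunit_inv Vm0.
  by apply: contra (vmaxN1 V) => m1; rewrite -(subrK (m0 ord0) 1) rpredD.
set d := 1 - m0 ord0 in d0 Vd; have dA : d%:A != 0 :> L by rewrite in_alg_eq0.
(* The expansion of [w ord0] contains [w ord0] itself with coefficient [m0 ord0] in the maximal
   ideal. So [d] is a unit, and solving for [w ord0] removes it from the expansion of [u]. *)
pose a := m ord0 / d.
exists (fun j => v j + a * v0 j), (fun i => m (lift ord0 i) + a * m0 (lift ord0 i)).
have Va : a \in vring V by rewrite rpredM // vmax_sub.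
split=> [j|i|]; first by apply: rpredD; [exact: Vv | apply: rpredM; [exact: Va | exact: Vv0]].
  by apply: rpredD; [exact: mm | apply: vmaxMl; [exact: Va | exact: mm0]].
have E (K : finType) (c c' : K -> F) (t : K -> L) :
    \sum_i (c i + a * c' i)%:A * t i = \sum_i (c i)%:A * t i + a%:A * \sum_i (c' i)%:A * t i.
  by rewrite mulr_sumr -big_split; apply: eq_bigr => i _; rewrite in_algD in_algM /=; ring.
rewrite !E big_ord_recl /=; rewrite big_ord_recl /= in w0E.
set A0 := \sum_j (v0 j)%:A * z j in w0E *; set B0 := \sum_i (m0 (lift ord0 i))%:A * _ in w0E *.
have wd : d%:A * w ord0 = A0 + B0.
  by rewrite /d in_algB scale1r mulrBl mul1r {1}w0E; ring.
have {wd} wE : (m ord0)%:A * w ord0 = a%:A * (A0 + B0).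
  by rewrite -wd mulrA -in_algM divfK.
by rewrite wE; ring.
Qed.

Lemma vspan_card (J : finType) (z : J -> L) : vspan V z ->
  (forall c : J -> F, \sum_j (c j)%:A * z j = 0 -> forall j, c j = 0) ->
  \dim (fullv : {vspace L}) = #|J|.
Proof.
move=> span free.
pose X := [tuple z (enum_val i) | i < #|J|].
have ev (g : J -> L) : \sum_(i < #|J|) g (enum_val i) = \sum_i g i.
  by rewrite -(big_enum_val (A := J) g).
have XE (i : 'I_#|J|) : X`_i = z (enum_val i) by rewrite -tnth_nth tnth_mktuple.
suff /size_basis-> : basis_of fullv X by [].
apply/andP; split; last first.
  apply/freeP => k k0 i.
  have := free (k \o enum_rank) _ (enum_val i); rewrite /= enum_valK; apply.
  rewrite -ev -[RHS]k0; apply: eq_bigr => j _.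
  by rewrite XE /= enum_valK mulr_algl.
rewrite eqEsubv subvf; apply/subvP => u _.
have [d Vd [d0 Sdu]] := sring_fraction V u.
have [v [_ /eqP]] := span _ Sdu; rewrite subr_eq0 -ev => /eqP duE.
have -> : u = d^-1 *: (d%:A * u) by rewrite mulr_algl scalerA mulVf // scale1r.
rewrite duE memvZ // memv_suml // => i _.
by rewrite mulr_algl memvZ // -XE memv_span // mem_nth // size_tuple.
Qed.

Lemma galois_system_defectless : defectless L V.
Proof.
move=> N HN; rewrite -(maxspec_ofK HN); set M := maxspec_of HN.
have [r [s [dis all]]] := maxspec_orbit M.
have [f [t tP]] := galois_residue_basis M.
have [z [Sz zfree zspan]] := crt_residue_basis dis (fun j => residue_pre (s j) tP).
exists 1%N, f, r; split.
- exact: galois_system_ram_index xy M.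
- by apply/res_degreeP; exists t.
- by apply/num_max_idealsP; exists (fun j => mxpre M (s j)).
(* The glued residue basis [z] has [r * f] members, and it suffices that it spans [S] over [V] and
   is free over [F]. *)
rewrite mul1n mulnC -[r]card_ord -[f]card_ord -card_prod; apply: vspan_card.
  apply: (@galois_residue_vspan M) => u Su; have [v [Vv Mv]] := zspan u Su.
  exists v; split=> // c; have [j jE] := all (mxpre M c).
  by rewrite -mxpreE jE.
by apply: (residue_free_free _ zfree) => j; rewrite rpred0.
Qed.

Lemma galois_system_unramified : unramified L V.
Proof.
move=> N HN; rewrite -(maxspec_ofK HN); split.
  exact: galois_system_ram_index xy _.
exact: galois_system_res_separable xy.
Qed.

End GaloisDefectless.

(** * The equivalence, through Galois systems *)

Theorem theorem2p5 (F : fieldType) (L : splittingFieldType F) (V : F -> Prop)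
  (f : galT L -> galT L -> L) :
  valuation_domain V ->
  galois 1%VS (fullv : {vspace L}) ->
  normalized_cocycle V f ->
  (azumaya V f <->
    [/\ (forall s : galT L, unitS V (f s s^-1%g)), unramified L V & defectless L V]).
Proof.
move=> HV HG Hf; pose W := GalVal HV HG; rewrite -[V]/(gv_pred W) in Hf *.
split=> [/(azumaya_units_galois_system Hf)[units [I [x [y xy]]]]|[units unr def]].
  by split=> //; [apply: galois_system_unramified xy | apply: galois_system_defectless xy].
have [I [x [y /galois_system_free[n [x' [y' [xy' x'_free]]]]]]] := galois_system_of_unramified unr def.
exact: (azumaya_of_galois_system Hf xy' units x'_free).
Qed.
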